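(* Let $\mathcal B$ be a Krull–Schmidt exact category with enough projectives and enough injectives, and let $(\mathcal U_1,\mathcal V_1)$ and $(\mathcal U_2,\mathcal V_2)$ be cotorsion pairs on $\mathcal B$. If $\mathcal K_1=\mathcal K_2$, where $\mathcal K_k=\operatorname{add}(\mathcal U_k*\mathcal V_k)$, then there is an equivalence $\mathcal H_1/\mathcal W_1\simeq\mathcal H_2/\mathcal W_2$ between the two hearts.
   Context: Exact category is meant in the sense of Quillen; short exact sequences are written $A\rightarrowtail B\twoheadrightarrow C$. A cotorsion pair on $\mathcal B$ is a pair $(\mathcal U,\mathcal V)$ of full additive subcategories closed under direct summands such that $\operatorname{Ext}^1_{\mathcal B}(\mathcal U,\mathcal V)=0$ and every $B\in\mathcal B$ admits short exact sequences $V_B\rightarrowtail U_B\twoheadrightarrow B$ and $B\rightarrowtail V^B\twoheadrightarrow U^B$ with $U_B,U^B\in\mathcal U$, $V_B,V^B\in\mathcal V$. For a cotorsion pair $(\mathcal U_k,\mathcal V_k)$ put $\mathcal W_k=\mathcal U_k\cap\mathcal V_k$. $\mathcal B_k^+$ consists of the objects $B$ admitting a short exact sequence $V_B\rightarrowtail W_B\twoheadrightarrow B$ with $V_B\in\mathcal V_k$, $W_B\in\mathcal W_k$; $\mathcal B_k^-$ consists of the objects $B$ admitting a short exact sequence $B\rightarrowtail W^B\twoheadrightarrow U^B$ with $W^B\in\mathcal W_k$, $U^B\in\mathcal U_k$; $\mathcal H_k=\mathcal B_k^+\cap\mathcal B_k^-$. The heart $\mathcal H_k/\mathcal W_k$ is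 the full subcategory on the objects of $\mathcal H_k$ of the ideal quotient $\mathcal B/\mathcal W_k$ (morphisms modulo those factoring through an object of $\mathcal W_k$); it is an abelian category. $\operatorname{add}(\mathcal U_k*\mathcal V_k)$ is the full subcategory of objects $X$ for which there exist an object $Y$ and a short exact sequence $U\rightarrowtail X\oplus Y\twoheadrightarrow V$ with $U\in\mathcal U_k$, $V\in\mathcal V_k$. *)

(* Defs.v *)
From HB Require Import structures.
From mathcomp Require Import all_boot all_order all_algebra.
From mathcomp Require Import boolp classical_sets.

Set Implicit Arguments.
Unset Strict Implicit.
Unset Printing Implicit Defensive.

Import GRing.Theory.
Local Open Scope quotient_scope.
Local Open Scope ring_scope.
Local Open Scope classical_set_scope.

(* Morphisms are compared with Leibniz equality.  The choiceType contained in
   each hom-group is no restriction: boolp makes every type a choiceType. *)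
Record preadditive := Preadditive {
  obj :> Type;
  hom : obj -> obj -> zmodType;
  idm : forall X, hom X X;
  comp : forall X Y Z, hom Y Z -> hom X Y -> hom X Z;
  compm1 : forall X Y (f : hom X Y), comp f (idm X) = f;
  comp1m : forall X Y (f : hom X Y), comp (idm Y) f = f;
  compA : forall X Y Z T (h : hom Z T) (g : hom Y Z) (f : hom X Y),
    comp h (comp g f) = comp (comp h g) f;
  compDl : forall X Y Z (g g' : hom Y Z) (f : hom X Y),
    comp (g + g') f = comp g f + comp g' f;
  compDr : forall X Y Z (g : hom Y Z) (f f' : hom X Y),
    comp g (f + f') = comp g f + comp g f' }.

Arguments hom {p} X Y.
Arguments idm {p} X.
Arguments comp {p X Y Z} g f.

Declare Scope cat_scope.
Delimit Scope cat_scope with cat.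
Notation "g ∘ f" := (comp g f) (at level 40, left associativity) : cat_scope.
Local Open Scope cat_scope.

Section PreadditiveTheory.
Variable C : preadditive.

Definition is_iso (X Y : C) (f : hom X Y) : Prop :=
  exists g : hom Y X, g ∘ f = idm X /\ f ∘ g = idm Y.

Definition is_zero_object (Z : C) : Prop :=
  (forall X (f : hom Z X), f = 0) /\ (forall X (f : hom X Z), f = 0).

Definition is_biproduct (A B S : C) (i1 : hom A S) (i2 : hom B S)
    (p1 : hom S A) (p2 : hom S B) : Prop :=
  [/\ p1 ∘ i1 = idm A, p2 ∘ i2 = idm B, p2 ∘ i1 = 0, p1 ∘ i2 = 0
    & i1 ∘ p1 + i2 ∘ p2 = idm S].

Definition is_direct_sum_of (A B S : C) : Prop :=
  exists (i1 : hom A S) (i2 : hom B S) (p1 : hom S A) (p2 : hom S B),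
    is_biproduct i1 i2 p1 p2.

Definition is_finite_direct_sum_of (n : nat) (A : 'I_n -> C) (S : C) : Prop :=
  exists (i : forall k, hom (A k) S) (p : forall k, hom S (A k)),
  [/\ forall k, p k ∘ i k = idm (A k),
      forall k l, k != l -> p k ∘ i l = 0
    & \sum_k i k ∘ p k = idm S].

Definition is_additive : Prop :=
  (exists Z, is_zero_object Z) /\ (forall A B, exists S, is_direct_sum_of A B S).

Definition is_kernel (A B D : C) (i : hom A B) (p : hom B D) : Prop :=
  p ∘ i = 0 /\
  forall T (f : hom T B), p ∘ f = 0 -> exists! g : hom T A, i ∘ g = f.

Definition is_cokernel (A B D : C) (i : hom A B) (p : hom B D) : Prop :=
  p ∘ i = 0 /\
  forall T (f : hom B T), f ∘ i = 0 -> exists! g : hom D T, g ∘ p = f.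

Definition is_pushout (A B A' B' : C) (i : hom A B) (f : hom A A')
    (i' : hom A' B') (f' : hom B B') : Prop :=
  f' ∘ i = i' ∘ f /\
  forall T (u : hom B T) (v : hom A' T), u ∘ i = v ∘ f ->
    exists! w : hom B' T, w ∘ f' = u /\ w ∘ i' = v.

Definition is_pullback (B D B' D' : C) (p : hom B D) (f : hom D' D)
    (p' : hom B' D') (f' : hom B' B) : Prop :=
  p ∘ f' = f ∘ p' /\
  forall T (u : hom T B) (v : hom T D'), p ∘ u = f ∘ v ->
    exists! w : hom T B', f' ∘ w = u /\ p' ∘ w = v.

(* The ring End(X) is local: it is nonzero and the sum of two non-units is a
   non-unit. *)
Definition has_local_End (X : C) : Prop :=
  idm X <> 0 /\
  forall f g : hom X X, ~ is_iso f -> ~ is_iso g -> ~ is_iso (f + g).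

Definition Krull_Schmidt : Prop :=
  forall X : C, exists (n : nat) (A : 'I_n -> C),
    (forall k, has_local_End (A k)) /\ is_finite_direct_sum_of A X.

End PreadditiveTheory.

Record additive_category := AdditiveCategory {
  additive_base :> preadditive;
  additiveP : is_additive additive_base }.

Section ExactAxioms.
Variable B : preadditive.
Variable conf : forall X Y Z : B, hom X Y -> hom Y Z -> Prop.

Definition inflation_of X Y (i : hom X Y) : Prop :=
  exists Z (p : hom Y Z), conf i p.

Definition deflation_of Y Z (p : hom Y Z) : Prop :=
  exists X (i : hom X Y), conf i p.

End ExactAxioms.

(* Quillen's axioms, in Keller's and Buehler's form. *)
Record exact_category := ExactCategory {
  exact_base :> additive_category;
  conflation : forall X Y Z : exact_base, hom X Y -> hom Y Z -> Prop;
  conflation_kernel : forall X Y Z (i : hom X Y) (p : hom Y Z),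
    conflation i p -> is_kernel i p;
  conflation_cokernel : forall X Y Z (i : hom X Y) (p : hom Y Z),
    conflation i p -> is_cokernel i p;
  conflation_iso : forall X Y Z X' Y' Z'
      (i : hom X Y) (p : hom Y Z) (i' : hom X' Y') (p' : hom Y' Z')
      (a : hom X X') (b : hom Y Y') (c : hom Z Z'),
    is_iso a -> is_iso b -> is_iso c ->
    b ∘ i = i' ∘ a -> c ∘ p = p' ∘ b -> conflation i p -> conflation i' p';
  inflation_id : forall X : exact_base, inflation_of conflation (idm X);
  deflation_id : forall X : exact_base, deflation_of conflation (idm X);
  inflation_comp : forall X Y Z (i : hom X Y) (j : hom Y Z),
    inflation_of conflation i -> inflation_of conflation j ->
    inflation_of conflation (j ∘ i);
  deflation_comp : forall X Y Z (p : hom X Y) (q : hom Y Z),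
    deflation_of conflation p -> deflation_of conflation q ->
    deflation_of conflation (q ∘ p);
  inflation_pushout : forall X Y X' (i : hom X Y) (f : hom X X'),
    inflation_of conflation i ->
    exists Y' (i' : hom X' Y') (f' : hom Y Y'),
      is_pushout i f i' f' /\ inflation_of conflation i';
  deflation_pullback : forall Y Z Z' (p : hom Y Z) (f : hom Z' Z),
    deflation_of conflation p ->
    exists Y' (p' : hom Y' Z') (f' : hom Y' Y),
      is_pullback p f p' f' /\ deflation_of conflation p' }.

Arguments conflation {e X Y Z} i p.

Section ExactTheory.
Variable B : exact_category.

Definition inflation (X Y : B) (i : hom X Y) : Prop :=
  inflation_of (@conflation B) i.

Definition deflation (Y Z : B) (p : hom Y Z) : Prop :=
  deflation_of (@conflation B) p.

Definition is_projective (P : B) : Prop :=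
  forall (Y Z : B) (p : hom Y Z) (f : hom P Z), deflation p ->
    exists g : hom P Y, p ∘ g = f.

Definition is_injective (I : B) : Prop :=
  forall (X Y : B) (i : hom X Y) (f : hom X I), inflation i ->
    exists g : hom Y I, g ∘ i = f.

Definition enough_projectives : Prop :=
  forall X : B, exists (P : B) (p : hom P X), is_projective P /\ deflation p.

Definition enough_injectives : Prop :=
  forall X : B, exists (I : B) (i : hom X I), is_injective I /\ inflation i.

(* Ext^1(Z, X) is the Yoneda group of short exact sequences X >-> Y ->> Z up
   to equivalence; its zero is the class of X >-> X (+) Z ->> Z. *)
Record extension (Z X : B) := Extension {
  ext_mid : B;
  ext_in : hom X ext_mid;
  ext_out : hom ext_mid Z;
  ext_conflation : conflation ext_in ext_out }.

(* The middle arrow is automatically an isomorphism. *)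
Definition Yoneda_equiv (Z X : B) (e e' : extension Z X) : Prop :=
  exists phi : hom (ext_mid e) (ext_mid e'),
    phi ∘ ext_in e = ext_in e' /\ ext_out e' ∘ phi = ext_out e.

Definition trivial_extension (Z X : B) (e : extension Z X) : Prop :=
  exists (s : hom Z (ext_mid e)) (r : hom (ext_mid e) X),
    is_biproduct (ext_in e) s r (ext_out e).

Definition Ext1_eq0 (Z X : B) : Prop :=
  forall e : extension Z X,
    exists e0, trivial_extension e0 /\ Yoneda_equiv e0 e.

End ExactTheory.

(* Full additive subcategories closed under direct summands, as sets of objects.
   Closure under isomorphism follows: X is a summand of every Y isomorphic to X. *)
Record addsubcat (B : preadditive) := AddSubcat {
  addsubcat_set :> B -> Prop;
  addsubcat0 : forall Z, is_zero_object Z -> addsubcat_set Z;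
  addsubcatD : forall X Y S, is_direct_sum_of X Y S ->
    addsubcat_set X -> addsubcat_set Y -> addsubcat_set S;
  addsubcat_summand : forall X Y S, is_direct_sum_of X Y S ->
    addsubcat_set S -> addsubcat_set X }.

Section AddSubcatI.
Variables (B : preadditive) (U V : addsubcat B).

Fact addsubcatI0 Z : is_zero_object Z -> U Z /\ V Z.
Proof. by move=> Z0; split; exact: addsubcat0. Qed.

Fact addsubcatID X Y S : is_direct_sum_of X Y S ->
  U X /\ V X -> U Y /\ V Y -> U S /\ V S.
Proof. by move=> sS [UX VX] [UY VY]; split; exact: addsubcatD sS _ _. Qed.

Fact addsubcatI_summand X Y S : is_direct_sum_of X Y S ->
  U S /\ V S -> U X /\ V X.
Proof. by move=> sS [US VS]; split; exact: addsubcat_summand sS _. Qed.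

Definition addsubcatI : addsubcat B :=
  @AddSubcat B (fun X => U X /\ V X) addsubcatI0 addsubcatID addsubcatI_summand.

End AddSubcatI.

Section CompTheory.
Variable C : preadditive.

Lemma comp0m (X Y Z : C) (f : hom X Y) : (0 : hom Y Z) ∘ f = 0.
Proof. by apply: (addIr ((0 : hom Y Z) ∘ f)); rewrite -compDl !add0r. Qed.

Lemma compm0 (X Y Z : C) (g : hom Y Z) : g ∘ (0 : hom X Y) = 0.
Proof. by apply: (addIr (g ∘ (0 : hom X Y))); rewrite -compDr !add0r. Qed.

Lemma compNm (X Y Z : C) (g : hom Y Z) (f : hom X Y) : (- g) ∘ f = - (g ∘ f).
Proof. by apply: (addIr (g ∘ f)); rewrite -compDl !addNr comp0m. Qed.

Lemma compmN (X Y Z : C) (g : hom Y Z) (f : hom X Y) : g ∘ (- f) = - (g ∘ f).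
Proof. by apply: (addIr (g ∘ f)); rewrite -compDr !addNr compm0. Qed.

End CompTheory.

Section IdealQuotient.
Variables (B : additive_category) (W : addsubcat B).

Definition factors_through (X Y : B) (f : hom X Y) : Prop :=
  exists (T : B) (g : hom X T) (h : hom T Y), W T /\ f = h ∘ g.

Definition factor_ideal (X Y : B) : {pred hom X Y} :=
  fun f => `[< factors_through f >].

Fact factor_ideal_zmod_closed X Y : zmod_closed (@factor_ideal X Y).
Proof.
split=> [|f f' /asboolP[T [g [h [WT ->]]]] /asboolP[T' [g' [h' [WT' ->]]]]].
  have [[Z Z0] _] := additiveP B.
  apply/asboolP; exists Z, 0, 0; split; first exact: addsubcat0.
  by rewrite compm0.
have [_ /(_ T T')[S sS]] := additiveP B.
have WS : W S by exact: addsubcatD sS _ _.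
have [i1 [i2 [p1 [p2 [p1i1 p2i2 p2i1 p1i2 _]]]]] := sS.
apply/asboolP; exists S, (i1 ∘ g + i2 ∘ g'), (h ∘ p1 - h' ∘ p2); split=> //.
rewrite compDl !compDr compNm compNm -!compA !(compA p1) !(compA p2).
by rewrite p1i1 p1i2 p2i1 p2i2 !comp1m !comp0m !compm0 addr0 oppr0 add0r.
Qed.

HB.instance Definition _ X Y :=
  GRing.isZmodClosed.Build (hom X Y) (@factor_ideal X Y)
    (factor_ideal_zmod_closed X Y).

Definition quot_hom (X Y : B) : zmodType := {ideal_quot (@factor_ideal X Y)}.

Definition quot_pi (X Y : B) (f : hom X Y) : quot_hom X Y :=
  \pi_({ideal_quot (@factor_ideal X Y)}) f.

Definition quot_comp (X Y Z : B) (g : quot_hom Y Z) (f : quot_hom X Y) :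
    quot_hom X Z :=
  quot_pi (repr g ∘ repr f).

Lemma quot_piP (X Y : B) (f f' : hom X Y) :
  quot_pi f = quot_pi f' <-> factors_through (f - f').
Proof.
split=> [/eqP|ff']; first by rewrite -Quotient.idealrBE => /asboolP.
by apply/eqP; rewrite -Quotient.idealrBE; apply/asboolP.
Qed.

Lemma quot_pi_surj (X Y : B) (f : quot_hom X Y) : quot_pi (repr f) = f.
Proof. exact: reprK. Qed.

Lemma quot_piD (X Y : B) (f f' : hom X Y) :
  quot_pi (f + f') = quot_pi f + quot_pi f'.
Proof. exact: Quotient.pi_add. Qed.

Lemma quot_comp_pi (X Y Z : B) (g : hom Y Z) (f : hom X Y) :
  quot_comp (quot_pi g) (quot_pi f) = quot_pi (g ∘ f).
Proof.
pose g' := repr (quot_pi g); pose f' := repr (quot_pi f).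
have gg' : factors_through (g' - g) by apply/quot_piP; exact: quot_pi_surj.
have ff' : factors_through (f' - f) by apply/quot_piP; exact: quot_pi_surj.
transitivity (quot_pi (g' ∘ f)); apply/quot_piP.
- have [T [a [b [WT ab]]]] := ff'.
  by exists T, a, (g' ∘ b); rewrite -compA -ab compDr compmN.
- have [T [a [b [WT ab]]]] := gg'.
  by exists T, (a ∘ f), b; rewrite compA -ab compDl compNm.
Qed.

Fact quot_compm1 X Y (f : quot_hom X Y) : quot_comp f (quot_pi (idm X)) = f.
Proof. by rewrite -(quot_pi_surj f) quot_comp_pi compm1. Qed.

Fact quot_comp1m X Y (f : quot_hom X Y) : quot_comp (quot_pi (idm Y)) f = f.
Proof. by rewrite -(quot_pi_surj f) quot_comp_pi comp1m. Qed.

Fact quot_compA X Y Z T (h : quot_hom Z T) (g : quot_hom Y Z)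
    (f : quot_hom X Y) :
  quot_comp h (quot_comp g f) = quot_comp (quot_comp h g) f.
Proof.
rewrite -(quot_pi_surj f) -(quot_pi_surj g) -(quot_pi_surj h).
by rewrite !quot_comp_pi compA.
Qed.

Fact quot_compDl X Y Z (g g' : quot_hom Y Z) (f : quot_hom X Y) :
  quot_comp (g + g') f = quot_comp g f + quot_comp g' f.
Proof.
rewrite -(quot_pi_surj f) -(quot_pi_surj g) -(quot_pi_surj g').
by rewrite -quot_piD !quot_comp_pi -quot_piD compDl.
Qed.

Fact quot_compDr X Y Z (g : quot_hom Y Z) (f f' : quot_hom X Y) :
  quot_comp g (f + f') = quot_comp g f + quot_comp g f'.
Proof.
rewrite -(quot_pi_surj f) -(quot_pi_surj f') -(quot_pi_surj g).
by rewrite -quot_piD !quot_comp_pi -quot_piD compDr.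
Qed.

Definition ideal_quotient : preadditive :=
  Preadditive quot_compm1 quot_comp1m quot_compA quot_compDl quot_compDr.

End IdealQuotient.

Definition full_subcat (C : preadditive) (P : set C) : preadditive :=
  @Preadditive {X : C | P X} (fun X Y => hom (sval X) (sval Y))
    (fun X => idm (sval X)) (fun X Y Z g f => g ∘ f)
    (fun X Y f => compm1 f) (fun X Y f => comp1m f)
    (fun X Y Z T h g f => compA h g f)
    (fun X Y Z g g' f => compDl g g' f)
    (fun X Y Z g f f' => compDr g f f').

Record functor (C D : preadditive) := Functor {
  fobj :> C -> D;
  fmap : forall X Y, hom X Y -> hom (fobj X) (fobj Y);
  fmap_id : forall X, fmap (idm X) = idm (fobj X);
  fmap_comp : forall X Y Z (g : hom Y Z) (f : hom X Y),
    fmap (g ∘ f) = fmap g ∘ fmap f }.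

Definition functor_id (C : preadditive) : functor C C :=
  @Functor C C id (fun X Y f => f) (fun X => erefl) (fun X Y Z g f => erefl).

Section FunctorComp.
Variables (C D E : preadditive) (G : functor D E) (F : functor C D).

Fact functor_comp_id X : fmap G (fmap F (idm X)) = idm (G (F X)).
Proof. by rewrite !fmap_id. Qed.

Fact functor_comp_comp X Y Z (g : hom Y Z) (f : hom X Y) :
  fmap G (fmap F (g ∘ f)) = fmap G (fmap F g) ∘ fmap G (fmap F f).
Proof. by rewrite !fmap_comp. Qed.

Definition functor_comp : functor C E :=
  @Functor C E (fun X => G (F X)) (fun X Y f => fmap G (fmap F f))
    functor_comp_id functor_comp_comp.

End FunctorComp.

Definition nat_isomorphic (C D : preadditive) (F G : functor C D) : Prop :=
  exists eta : forall X, hom (F X) (G X),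
    (forall X, is_iso (eta X)) /\
    (forall X Y (f : hom X Y), eta Y ∘ fmap F f = fmap G f ∘ eta X).

(* No additivity is asked of the functors: an equivalence between additive
   categories preserves biproducts, hence sums of morphisms. *)
Definition equivalent (C D : preadditive) : Prop :=
  exists (F : functor C D) (G : functor D C),
    nat_isomorphic (functor_comp G F) (functor_id C) /\
    nat_isomorphic (functor_comp F G) (functor_id D).

Record cotorsion_pair (B : exact_category) := CotorsionPair {
  cotU : addsubcat B;
  cotV : addsubcat B;
  cot_Ext1 : forall U V, cotU U -> cotV V -> Ext1_eq0 U V;
  cot_left : forall X : B, exists (V U : B) (i : hom V U) (p : hom U X),
    [/\ cotV V, cotU U & conflation i p];
  cot_right : forall X : B, exists (V U : B) (i : hom X V) (p : hom V U),
    [/\ cotV V, cotU U & conflation i p] }.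

Section Heart.
Variables (B : exact_category) (c : cotorsion_pair B).

Definition cotW : addsubcat B := addsubcatI (cotU c) (cotV c).

Definition cot_plus : set B := [set X |
  exists (V W : B) (i : hom V W) (p : hom W X),
    [/\ cotV c V, cotW W & conflation i p]].

Definition cot_minus : set B := [set X |
  exists (W U : B) (i : hom X W) (p : hom W U),
    [/\ cotW W, cotU c U & conflation i p]].

Definition cotH : set B := cot_plus `&` cot_minus.

Definition heart : preadditive :=
  @full_subcat (ideal_quotient cotW) cotH.

Definition cotK : set B := [set X |
  exists Y S : B, is_direct_sum_of X Y S /\
  exists (U V : B) (i : hom U S) (p : hom S V),
    [/\ cotU c U, cotV c V & conflation i p]].

End Heart.

(* Main.v *)
From mathcomp Require Import all_boot ssralg boolp.
Require Import Defs.

Set Implicit Arguments.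
Unset Strict Implicit.
Unset Printing Implicit Defensive.

Import GRing.Theory.
Local Open Scope ring_scope.
Local Open Scope cat_scope.

(** Let (U, V) be a cotorsion pair, W the intersection of U and V, and compute
    in the quotient B/W.  Every object X has a reflection X -> X^+ into B^+ and
    a coreflection X^- -> X into B^-.  There is an object HX of the heart and a
    commutative square X^- -> HX -> X^+ over X^- -> X -> X^+ in which
    X^- -> HX is again a reflection and HX -> X^+ again a coreflection
    [exists_heart_datum].  So H is a functor from B to the heart: an arrow
    X -> Y passes to reflections and then lifts to coreflections [heart_map].
    It is naturally the identity on the heart [heart_map_on_heart,
    heart_map_natural].

    The theorem holds because both the kernel of H and enough of the arrows
    that H inverts are described by K = add(U * V) alone.  A deflation with
    kernel in K becomes monic in the heart [Kmono_heart_mono]: it suffices to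
    treat kernels in U and kernels in V, and there the reflections of source
    and target can be computed from compatible resolutions
    [heart_mono_cotU, heart_mono_cotV].  In particular H kills K
    [heart_cotK].  Dually, inflations with cokernel in K become epic.  The
    heart is balanced: a monomorphism that is an epimorphism is invertible
    [heart_balanced].  Hence H inverts an arrow which, after adding a summand
    to its source, is a deflation with kernel in K and, after adding a summand
    to its target, is an inflation with cokernel in K.

    Both arrows X -> X^+ <- HX are of this kind, because they are sides of
    bicartesian squares whose other corners lie in U or V.  Now take two pairs
    with the same K.  Since W_1 lies in K, the functor H_2 induces a functor
    from the first heart to the second, and H_1 inverts the two arrows
    X -> X^+ <- H_2 X formed for the second pair.  So H_1 H_2 X is naturally
    isomorphic to H_1 X, hence to X for X in the first heart [round_trip], and
    the argument is symmetric in the two pairs. *)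

(** * Preadditive categories and opposites *)

Section Preadditive.
Variable C : preadditive.

Lemma compBl (X Y Z : C) (g g' : hom Y Z) (f : hom X Y) :
  (g - g') ∘ f = g ∘ f - g' ∘ f.
Proof. by rewrite compDl compNm. Qed.

Lemma compBr (X Y Z : C) (g : hom Y Z) (f f' : hom X Y) :
  g ∘ (f - f') = g ∘ f - g ∘ f'.
Proof. by rewrite compDr compmN. Qed.

Lemma is_iso_id (X : C) : is_iso (idm X).
Proof. by exists (idm X); rewrite compm1. Qed.

Lemma is_iso_comp (X Y Z : C) (g : hom Y Z) (f : hom X Y) :
  is_iso g -> is_iso f -> is_iso (g ∘ f).
Proof.
move=> [g' [g'g gg']] [f' [f'f ff']]; exists (f' ∘ g'); split.
  by rewrite compA -(compA f') g'g compm1 f'f.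
by rewrite compA -(compA g) ff' compm1 gg'.
Qed.

Lemma direct_sum_sym (A A' S : C) :
  is_direct_sum_of A A' S -> is_direct_sum_of A' A S.
Proof.
move=> [i1 [i2 [p1 [p2 [e1 e2 e3 e4 e5]]]]]; exists i2, i1, p2, p1.
by split; rewrite // addrC.
Qed.

(** Every dual statement below is an instance of its original in the opposite
    category: composition is swapped and nothing else changes, so kernels,
    pullbacks and conflations of the opposite are, by conversion, cokernels,
    pushouts and conflations. *)
Definition op_preadditive : preadditive :=
  @Preadditive C (fun X Y => hom Y X) (fun X => idm X)
    (fun X Y Z g f => f ∘ g)
    (fun X Y f => comp1m f) (fun X Y f => compm1 f)
    (fun X Y Z T h g f => esym (compA f g h))
    (fun X Y Z g g' f => compDr f g g')
    (fun X Y Z g f f' => compDl f f' g).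

Lemma direct_sum_op (A A' S : C) :
  is_direct_sum_of A A' S <-> @is_direct_sum_of op_preadditive A A' S.
Proof.
by split=> -[i1 [i2 [p1 [p2 [e1 e2 e3 e4 e5]]]]]; exists p1, p2, i1, i2.
Qed.

Lemma zero_object_op (Z : C) :
  is_zero_object Z <-> @is_zero_object op_preadditive Z.
Proof. by split=> -[]. Qed.

Lemma is_iso_op (X Y : C) (f : hom X Y) :
  is_iso f <-> @is_iso op_preadditive Y X f.
Proof. by split=> -[g [gf fg]]; exists g. Qed.

End Preadditive.

Fact op_is_additive (C : additive_category) : is_additive (op_preadditive C).
Proof.
have [[Z /zero_object_op Z0] S] := additiveP C; split; first by exists Z.
by move=> X Y; have [T /direct_sum_op sT] := S X Y; exists T.
Qed.

Definition op_additive (C : additive_category) : additive_category :=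
  AdditiveCategory (op_is_additive C).

Definition op_conflation (B : exact_category) (X Y Z : op_additive B)
    (i : hom X Y) (p : hom Y Z) : Prop := @conflation B Z Y X p i.

Definition op_exact (B : exact_category) : exact_category.
Proof.
refine (@ExactCategory (op_additive B) (@op_conflation B)
  _ _ _ _ _ _ _ _ _).
- by move=> X Y Z i p /conflation_cokernel.
- by move=> X Y Z i p /conflation_kernel.
- move=> X Y Z X' Y' Z' i p i' p' a b c /is_iso_op[a' [a'a aa']].
  move=> /is_iso_op[b' [b'b bb']] /is_iso_op[c' [c'c cc']] /= ebi ecp.
  apply: (@conflation_iso B _ _ _ _ _ _ p i p' i' c' b' a').
  + by exists c.
  + by exists b.
  + by exists a.
  + by rewrite -[b' ∘ p]compm1 -cc' compA -(compA b') ecp compA b'b comp1m.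
  + by rewrite -[a' ∘ i]compm1 -bb' compA -(compA a') ebi compA a'a comp1m.
- exact: (@deflation_id B).
- exact: (@inflation_id B).
- by move=> X Y Z i j di dj; apply: (@deflation_comp B Z Y X j i).
- by move=> X Y Z p q ip iq; apply: (@inflation_comp B Z Y X q p).
- by move=> X Y X' i f; apply: (@deflation_pullback B Y X X' i f).
- by move=> Y Z Z' p f; apply: (@inflation_pushout B Z Y Z' p f).
Defined.

(** * Conflations and base change *)

Section Exact.
Variable B : exact_category.

Section Conflation.
Variables (X Y Z : B) (i : hom X Y) (p : hom Y Z).
Hypothesis cip : conflation i p.

Lemma conf_comp0 : p ∘ i = 0.
Proof. by case: (conflation_kernel cip). Qed.

Lemma conf_mono T (g g' : hom T X) : i ∘ g = i ∘ g' -> g = g'.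
Proof.
have [_ ker] := conflation_kernel cip => e.
have [|h [_ hu]] := ker T (i ∘ g); first by rewrite compA conf_comp0 comp0m.
by rewrite -(hu g) // -(hu g').
Qed.

Lemma conf_epi T (g g' : hom Z T) : g ∘ p = g' ∘ p -> g = g'.
Proof.
have [_ coker] := conflation_cokernel cip => e.
have [|h [_ hu]] := coker T (g ∘ p); first by rewrite -compA conf_comp0 compm0.
by rewrite -(hu g) // -(hu g').
Qed.

Lemma conf_lift T (f : hom T Y) : p ∘ f = 0 -> exists g, i ∘ g = f.
Proof.
by have [_ ker] := conflation_kernel cip => /ker[g [gf _]]; exists g.
Qed.

Lemma conf_desc T (f : hom Y T) : f ∘ i = 0 -> exists g, g ∘ p = f.
Proof.
by have [_ coker] := conflation_cokernel cip => /coker[g [gf _]]; exists g.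
Qed.

Lemma section_split (s : hom Z Y) :
  p ∘ s = idm Z -> exists r, is_biproduct i s r p.
Proof.
move=> ps; have [|r er] := @conf_lift Y (idm Y - s ∘ p).
  by rewrite compBr compm1 compA ps comp1m subrr.
exists r; split=> //.
- by apply: conf_mono; rewrite compA er compBl -compA conf_comp0 compm0 subr0
    comp1m compm1.
- exact: conf_comp0.
- by apply: conf_mono; rewrite compA er compBl -compA ps compm1 comp1m subrr
    compm0.
- by rewrite er subrK.
Qed.

End Conflation.

(** An inflation has a cokernel that makes it a conflation; cokernels are
    unique up to isomorphism and conflations are closed under isomorphism. *)
Lemma conflation_of_cokernel (X Y Z : B) (i : hom X Y) (p : hom Y Z) :
  inflation i -> is_cokernel i p -> conflation i p.
Proof.
move=> [Z' [q ciq]] [pi coker].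
have [c ecq] := conf_desc ciq pi.
have [d [edp _]] := coker _ _ (conf_comp0 ciq).
have ic : is_iso c.
  exists d; split.
    by apply: (conf_epi ciq); rewrite -compA ecq edp comp1m.
  have [w [_ wu]] := coker _ p pi.
  by rewrite -(wu (c ∘ d)) ?(wu (idm Z)) ?comp1m // -compA edp.
apply: (conflation_iso (is_iso_id X) (is_iso_id Y) ic _ _ ciq).
  by rewrite comp1m compm1.
by rewrite compm1.
Qed.

End Exact.

Section ExactOp.
Variable B : exact_category.

Lemma retraction_split (X Y Z : B) (i : hom X Y) (p : hom Y Z) (r : hom Y X) :
  conflation i p -> r ∘ i = idm X -> exists s, is_biproduct i s r p.
Proof.
move=> cip ri; have [s [e1 e2 e3 e4 e5]] :=
  @section_split (op_exact B) Z Y X p i cip r ri.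
by exists s; split; rewrite // addrC.
Qed.

Lemma conflation_of_kernel (X Y Z : B) (i : hom X Y) (p : hom Y Z) :
  deflation p -> is_kernel i p -> conflation i p.
Proof. exact: (@conflation_of_cokernel (op_exact B) Z Y X p i). Qed.

Lemma pullback_inj (X Y X' Y' : B) (p : hom X Y) (f : hom Y' Y)
    (p' : hom X' Y') (f' : hom X' X) T (g g' : hom T X') :
  is_pullback p f p' f' -> f' ∘ g = f' ∘ g' -> p' ∘ g = p' ∘ g' -> g = g'.
Proof.
move=> [e pb] ef ep; have [|w [_ wu]] := pb T (f' ∘ g) (p' ∘ g).
  by rewrite !compA e.
by rewrite -(wu g) // -(wu g').
Qed.

Lemma pullback_deflation (X Y X' Y' : B) (p : hom X Y) (f : hom Y' Y)
    (p' : hom X' Y') (f' : hom X' X) :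
  is_pullback p f p' f' -> deflation p -> deflation p'.
Proof.
move=> pb dp; have [X1 [p1 [f1 [pb1 [K [i cip]]]]]] := deflation_pullback f dp.
have [w [[w1 w2] _]] := pb1.2 _ _ _ pb.1.
have [w' [[w1' w2'] _]] := pb.2 _ _ _ pb1.1.
have iw : is_iso w'.
  exists w; split.
    by apply: (pullback_inj pb1); rewrite compA ?w1 ?w2 ?w1' ?w2' compm1.
  by apply: (pullback_inj pb); rewrite compA ?w1' ?w2' ?w1 ?w2 compm1.
exists K, (w' ∘ i).
apply: (conflation_iso (is_iso_id K) iw (is_iso_id Y') _ _ cip).
  by rewrite compm1.
by rewrite w2' comp1m.
Qed.

Lemma pullback_conflation (K X Y X' Y' : B) (i : hom K X) (p : hom X Y)
    (f : hom Y' Y) (p' : hom X' Y') (f' : hom X' X) :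
  is_pullback p f p' f' -> conflation i p ->
  exists i', f' ∘ i' = i /\ conflation i' p'.
Proof.
move=> pb cip.
have [|i' [[fi' pi'] _]] := pb.2 K i 0.
  by rewrite (conf_comp0 cip) compm0.
exists i'; split=> //; apply: conflation_of_kernel.
  by apply: pullback_deflation pb _; exists K, i.
split=> // T g pg.
have [|h eh] := @conf_lift _ _ _ _ _ _ cip T (f' ∘ g).
  by rewrite compA pb.1 -compA pg compm0.
exists h; split.
  by apply: (pullback_inj pb); rewrite compA ?fi' // pi' comp0m.
by move=> h' eh'; apply: (conf_mono cip); rewrite eh -eh' compA fi'.
Qed.

Lemma base_change (K X Y Y' : B) (i : hom K X) (p : hom X Y) (f : hom Y' Y) :
  conflation i p -> exists X' (i' : hom K X') (p' : hom X' Y') (f' : hom X' X),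
    [/\ is_pullback p f p' f', conflation i' p' & f' ∘ i' = i].
Proof.
move=> cip; have dp : deflation p by exists K, i.
have [X' [p' [f' [pb _]]]] := deflation_pullback f dp.
by have [i' [fi' cip']] := pullback_conflation pb cip; exists X', i', p', f'.
Qed.

Lemma pullback_sym (X Y X' Y' : B) (p : hom X Y) (f : hom Y' Y)
    (p' : hom X' Y') (f' : hom X' X) :
  is_pullback p f p' f' -> is_pullback f p f' p'.
Proof.
move=> [e pb]; split=> // T u v uv; have [w [[w1 w2] wu]] := pb T v u (esym uv).
by exists w; split=> // w' [w1' w2']; apply: wu.
Qed.

(** The two projections of one pullback are both deflations, each with the
    kernel of the opposite side. *)
Lemma common_pullback (K L X X' Y : B) (i : hom K X) (p : hom X Y)
    (i' : hom L X') (p' : hom X' Y) :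
  conflation i p -> conflation i' p' ->
  exists G (a : hom K G) (b : hom L G) (g : hom G X) (g' : hom G X'),
    [/\ is_pullback p p' g' g, conflation a g', conflation b g,
        g ∘ a = i & g' ∘ b = i'].
Proof.
move=> cip cip'; have [G [a [g' [g [pb ca ga]]]]] := base_change p' cip.
have [b [gb cb]] := pullback_conflation (pullback_sym pb) cip'.
by exists G, a, b, g, g'.
Qed.

(** A biproduct is a pullback over a zero object, which the trivial inflation
    id : X >-> X supplies as its cokernel. *)
Lemma biproduct_conflation (X Y S : B) (i1 : hom X S) (i2 : hom Y S)
    (p1 : hom S X) (p2 : hom S Y) :
  is_biproduct i1 i2 p1 p2 -> conflation i1 p2.
Proof.
move=> [e1 e2 e3 e4 e5].
have [Z [q cq]] := inflation_id X.
have q0 : q = 0 by rewrite -[q]compm1 (conf_comp0 cq).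
have [|j [ej cj]] := @pullback_conflation X X Z S Y (idm X) q 0 p2 p1 _ cq.
  split=> [|T u v _]; first by rewrite q0 !comp0m.
  exists (i1 ∘ u + i2 ∘ v); split.
    by rewrite !compDr !compA e1 e2 e3 e4 !comp0m !comp1m addr0 add0r.
  by move=> w [<- <-]; rewrite !compA -compDl e5 comp1m.
have <- : j = i1; last exact: cj.
by rewrite -[j]comp1m -e5 compDl -!compA ej (conf_comp0 cj) compm0 compm1 addr0.
Qed.

End ExactOp.

(** * Noether isomorphisms and bicartesian squares *)

Section Noether.
Variable B : exact_category.

Lemma cobase_change (X Y Z X' : B) (i : hom X Y) (p : hom Y Z) (f : hom X X') :
  conflation i p -> exists Y' (i' : hom X' Y') (p' : hom Y' Z) (f' : hom Y Y'),
    [/\ is_pushout i f i' f', conflation i' p' & p' ∘ f' = p].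
Proof.
move=> cip.
have [Y' [p' [i' [f' [po c e]]]]] :=
  @base_change (op_exact B) Z Y X X' p i f cip.
by exists Y', i', p', f'.
Qed.

Lemma pushout_inj (X Y X' Y' : B) (i : hom X Y) (f : hom X X')
    (i' : hom X' Y') (f' : hom Y Y') T (g g' : hom Y' T) :
  is_pushout i f i' f' -> g ∘ f' = g' ∘ f' -> g ∘ i' = g' ∘ i' -> g = g'.
Proof. exact: (@pullback_inj (op_exact B) Y X Y' X' i f i' f' T g g'). Qed.

(** The third isomorphism theorem for V in U in W, with X = U/V, P = W/V and
    U' = W/U. The cokernel t is a parameter so that two applications can be
    made to share it. *)
Lemma noether (V U X W U' P : B) (v : hom V U) (u : hom U X) (j : hom U W)
    (k : hom W U') (t : hom W P) :
  conflation v u -> conflation j k -> conflation (j ∘ v) t ->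
  exists (s : hom X P) (q : hom P U'),
    [/\ conflation s q, t ∘ j = s ∘ u & q ∘ t = k].
Proof.
move=> cvu cjk cjvt.
have [|s esu] := conf_desc cvu (f := t ∘ j).
  by rewrite -compA (conf_comp0 cjvt).
have [|q eqt] := conf_desc cjvt (f := k).
  by rewrite compA (conf_comp0 cjk) comp0m.
exists s, q; split=> //.
have [Y [i' [p' [f' [po cip' epf]]]]] := cobase_change u cjk.
have [w [[wf wi] _]] := po.2 _ t s (esym esu).
have [|w' ew'] := conf_desc cjvt (f := f').
  by rewrite compA po.1 -compA (conf_comp0 cvu) compm0.
have iw : is_iso w.
  exists w'; split; last first.
    by apply: (conf_epi cjvt); rewrite -compA ew' wf comp1m.
  apply: (pushout_inj po); first by rewrite -compA wf ew' comp1m.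
  rewrite -compA wi comp1m; apply: (conf_epi cvu).
  by rewrite -compA esu compA ew' po.1.
apply: (conflation_iso (is_iso_id X) iw (is_iso_id U') _ _ cip').
  by rewrite wi compm1.
rewrite comp1m; apply: (pushout_inj po); first by rewrite epf -compA wf.
rewrite (conf_comp0 cip') -compA wi; apply: (conf_epi cvu).
by rewrite comp0m -compA esu compA eqt (conf_comp0 cjk).
Qed.

Lemma conflation_comp_in (X Y Z T S : B) (i : hom X Y) (p : hom Y S)
    (j : hom Y Z) (q : hom Z T) :
  conflation i p -> conflation j q ->
  exists P (t : hom Z P), conflation (j ∘ i) t.
Proof.
by move=> ci cj; apply: inflation_comp; [exists S, p | exists T, q].
Qed.

(** A morphism of conflations that is the identity on kernels is a pullback
    square. The pulled back conflation over T splits, since the difference of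
    the two composites into Y' retracts its kernel onto A. *)
Lemma weak_pullback (A Y X Y' X' : B) (i : hom A Y) (p : hom Y X)
    (i' : hom A Y') (p' : hom Y' X') (g : hom Y Y') (f : hom X X') T
    (m : hom T X) (n : hom T Y') :
  conflation i p -> conflation i' p' -> g ∘ i = i' -> p' ∘ g = f ∘ p ->
  f ∘ m = p' ∘ n -> exists x : hom T Y, p ∘ x = m /\ g ∘ x = n.
Proof.
move=> cip cip' gi pg fm.
have [S [i0 [p0 [h [pb c0 hi]]]]] := base_change m cip.
have [|r er] := conf_lift cip' (f := g ∘ h - n ∘ p0).
  by rewrite compBr !compA pg -fm -!compA pb.1 subrr.
have [|s [_ _ _ rs sp]] := retraction_split (r := r) c0.
  apply: (conf_mono cip'); rewrite compA er compBl -!compA hi (conf_comp0 c0).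
  by rewrite compm0 subr0 gi compm1.
have ps : p0 ∘ s = idm T.
  apply: (conf_epi c0); rewrite -compA comp1m.
  have := congr1 (comp p0) sp.
  by rewrite compDr compA (conf_comp0 c0) comp0m add0r compm1.
exists (h ∘ s); rewrite !compA pb.1 -compA ps compm1; split=> //.
apply/eqP; rewrite -subr_eq0 -[X in _ - X]compm1 -ps compA -compBl -er -compA.
by rewrite rs compm0.
Qed.

(** Allows a kernel that is a summand of S to be replaced by S itself. *)
Lemma add_summand (A A' S G Y : B) (i1 : hom A S) (i2 : hom A' S)
    (p1 : hom S A) (p2 : hom S A') (a : hom A G) (b : hom G Y) :
  is_biproduct i1 i2 p1 p2 -> conflation a b ->
  exists G' (j1 : hom G G') (q1 : hom G' G) (a' : hom S G') (b' : hom G' Y),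
    [/\ q1 ∘ j1 = idm G, conflation a' b' & b' ∘ j1 = b].
Proof.
move=> [e1 e2 e3 e4 e5] cab.
have [_ /(_ G A')[G' [j1 [j2 [q1 [q2 biG]]]]]] := additiveP B.
have [f1 f2 f3 f4 f5] := biG.
exists G', j1, q1, (j1 ∘ a ∘ p1 + j2 ∘ p2), (b ∘ q1).
split=> //; last by rewrite -compA f1 compm1.
apply: conflation_of_kernel.
  apply: deflation_comp; last by exists A, a.
  exists A', j2; apply: (@biproduct_conflation B A' G G' j2 j1 q2 q1).
  by split; rewrite // addrC.
split=> [|T g].
  rewrite compDr !compA -(compA b) f1 compm1 (conf_comp0 cab) comp0m.
  by rewrite -(compA b) f4 compm0 comp0m addr0.
rewrite -compA => bg; have [h eh] := conf_lift cab bg.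
exists (i1 ∘ h + i2 ∘ (q2 ∘ g)); split.
  rewrite compDl !compDr -!compA !(compA p1) !(compA p2) e1 e2 e3 e4 !comp0m.
  by rewrite !comp1m !compm0 addr0 add0r eh !compA -compDl f5 comp1m.
move=> w ew; rewrite -[RHS]comp1m -e5 [RHS]compDl -!compA.
congr (_ + _); congr (comp _ _).
  apply: (conf_mono cab); rewrite eh -ew compDl compDr -!compA !(compA q1).
  by rewrite f1 f4 comp1m comp0m addr0.
by rewrite -ew compDl compDr -!compA !(compA q2) f2 f3 comp1m comp0m add0r.
Qed.

(** A morphism of conflations that is the identity on cokernels is a
    bicartesian square, so that U >-> X (+) W ->> P is a conflation. The
    common pullback of k and q is X (+) W because t provides a section of its
    projection to W. *)
Lemma bicartesian (U W C X P : B) (j : hom U W) (k : hom W C) (s : hom X P)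
    (q : hom P C) (u : hom U X) (t : hom W P) :
  conflation j k -> conflation s q -> t ∘ j = s ∘ u -> q ∘ t = k ->
  exists G (i1 : hom X G) (i2 : hom W G) (p1 : hom G X) (p2 : hom G W)
      (a : hom U G) (b : hom G P),
    [/\ is_biproduct i1 i2 p1 p2, conflation a b,
        b ∘ i1 = s /\ b ∘ i2 = t & p1 ∘ a = - u /\ p2 ∘ a = j].
Proof.
move=> cjk csq tj qt.
have [G [a [b [g [g' [pb ca cb ga gb]]]]]] := common_pullback cjk csq.
have [|w [[w1 w2] _]] := pb.2 W (idm W) t; first by rewrite compm1 qt.
have [r bi] := section_split cb w1.
exists G, b, w, r, g, a, g'; split=> //; split=> //.
apply: (conf_mono csq); rewrite compmN -tj -gb; have [_ _ _ _ e] := bi.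
have := congr1 (fun x => g' ∘ x ∘ a) e.
rewrite /= compDr compDl compm1 (conf_comp0 ca) !compA w2 -!compA ga !compA.
by move/eqP; rewrite addr_eq0 => /eqP.
Qed.

End Noether.

Section NoetherOp.
Variable B : exact_category.

Lemma noether_op (V F E U U' F' : B) (i : hom V F) (p : hom F E)
    (j : hom U E) (q : hom E U') (k : hom F' F) :
  conflation i p -> conflation j q -> conflation k (q ∘ p) ->
  exists (i' : hom V F') (p' : hom F' U),
    [/\ conflation i' p', p ∘ k = j ∘ p' & k ∘ i' = i].
Proof.
move=> cip cjq ck; have [s [r [c1 c2 c3]]] :=
  @noether (op_exact B) U' E U F V F' q j p i k cjq cip ck.
by exists r, s.
Qed.

Lemma conflation_comp_out (X Y Z T S : B) (i : hom S X) (p : hom X Y)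
    (j : hom T Y) (q : hom Y Z) :
  conflation i p -> conflation j q ->
  exists K (k : hom K X), conflation k (q ∘ p).
Proof.
move=> ci cj; exact: (@conflation_comp_in (op_exact B) Z Y X S T q j p i cj ci).
Qed.

Lemma weak_pushout (A Y X A' Y' : B) (i : hom A Y) (p : hom Y X)
    (i' : hom A' Y') (p' : hom Y' X) (f : hom A A') (g : hom Y Y') T
    (m : hom A' T) (n : hom Y T) :
  conflation i p -> conflation i' p' -> p' ∘ g = p -> g ∘ i = i' ∘ f ->
  m ∘ f = n ∘ i -> exists x : hom Y' T, x ∘ i' = m /\ x ∘ g = n.
Proof.
move=> c c' e1 e2 e3.
exact: (@weak_pullback (op_exact B) X Y' A' Y A p' i' p i g f T m n
  c' c e1 e2 e3).
Qed.

Lemma bicartesian_op (A X Y X' Y' : B) (i : hom A X) (p : hom X Y)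
    (i' : hom A X') (p' : hom X' Y') (f : hom X X') (g : hom Y Y') :
  conflation i p -> conflation i' p' -> f ∘ i = i' -> p' ∘ f = g ∘ p ->
  exists G (i1 : hom Y G) (i2 : hom X' G) (p1 : hom G Y) (p2 : hom G X')
      (a : hom X G) (b : hom G Y'),
    [/\ is_biproduct i1 i2 p1 p2, conflation a b,
        b ∘ i1 = - g /\ b ∘ i2 = p' & p1 ∘ a = p /\ p2 ∘ a = f].
Proof.
move=> c c' e1 e2; have [G [p1 [p2 [i1 [i2 [b [a [bi cab e3 e4]]]]]]]] :=
  @bicartesian (op_exact B) Y' X' A Y X p' i' p i g f c' c e2 e1.
exists G, i1, i2, p1, p2, a, b; split=> //.
by have [f1 f2 f3 f4 f5] := bi; split.
Qed.

End NoetherOp.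

(** * Cotorsion pairs *)

Section Ext.
Variable B : exact_category.

Lemma Ext1_section (Z X E : B) (i : hom X E) (p : hom E Z) :
  Ext1_eq0 Z X -> conflation i p -> exists s, p ∘ s = idm Z.
Proof.
move=> ext0 cip; have [e0 [[s [r [_ os _ _ _]]] [phi [_ ophi]]]] :=
  ext0 (Extension cip).
by exists (phi ∘ s); rewrite -os -[in RHS]ophi compA.
Qed.

Lemma Ext1_eq0I (Z X : B) :
  (forall (E : B) (i : hom X E) (p : hom E Z), conflation i p ->
     exists s, p ∘ s = idm Z) -> Ext1_eq0 Z X.
Proof.
move=> spl e; exists e; split.
  have [s ps] := spl _ _ _ (ext_conflation e).
  by have [r bi] := section_split (ext_conflation e) ps; exists s, r.
by exists (idm _); rewrite comp1m compm1.
Qed.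

End Ext.

Lemma Ext1_op (B : exact_category) (Z X : B) :
  Ext1_eq0 Z X -> @Ext1_eq0 (op_exact B) X Z.
Proof.
move=> ext0; apply: (@Ext1_eq0I (op_exact B)) => E i p cip.
have [s ps] := Ext1_section ext0 cip.
by have [r [ri _ _ _ _]] := @section_split B _ _ _ _ _ cip s ps; exists r.
Qed.

Fact op_addsubcat0 (B : preadditive) (U : addsubcat B) (Z : op_preadditive B) :
  is_zero_object Z -> U Z.
Proof. by move=> /(@zero_object_op B); exact: (@addsubcat0 B U). Qed.

Fact op_addsubcatD (B : preadditive) (U : addsubcat B)
    (X Y S : op_preadditive B) : is_direct_sum_of X Y S -> U X -> U Y -> U S.
Proof. by move=> /(@direct_sum_op B); exact: (@addsubcatD B U). Qed.

Fact op_addsubcat_summand (B : preadditive) (U : addsubcat B)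
    (X Y S : op_preadditive B) : is_direct_sum_of X Y S -> U S -> U X.
Proof. by move=> /(@direct_sum_op B); exact: (@addsubcat_summand B U). Qed.

Definition op_addsubcat (B : preadditive) (U : addsubcat B) :
    addsubcat (op_preadditive B) :=
  AddSubcat (@op_addsubcat0 B U) (@op_addsubcatD B U)
    (@op_addsubcat_summand B U).

Definition op_cotorsion (B : exact_category) (c : cotorsion_pair B) :
  cotorsion_pair (op_exact B).
Proof.
apply: (@CotorsionPair (op_exact B) (op_addsubcat (cotV c))
  (op_addsubcat (cotU c))).
- by move=> U V /= VU UV; apply: Ext1_op; exact: cot_Ext1 UV VU.
- move=> X; have [V [U [i [p [VV UU cip]]]]] := cot_right c X.
  by exists U, V, p, i.
- move=> X; have [V [U [i [p [VV UU cip]]]]] := cot_left c X.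
  by exists U, V, p, i.
Defined.

Section Cotorsion.
Variables (B : exact_category) (c : cotorsion_pair B).

Lemma cot_lift (V Y X T : B) (i : hom V Y) (p : hom Y X) (f : hom T X) :
  cotV c V -> cotU c T -> conflation i p -> exists g, p ∘ g = f.
Proof.
move=> VV UT cip; have [Y' [i' [p' [f' [pb c' _]]]]] := base_change f cip.
have [s ps] := Ext1_section (cot_Ext1 UT VV) c'.
by exists (f' ∘ s); rewrite compA pb.1 -compA ps compm1.
Qed.

Lemma cotU_of_section (V U X : B) (v : hom V U) (u : hom U X) (x : hom X U) :
  cotU c U -> conflation v u -> u ∘ x = idm X -> cotU c X.
Proof.
move=> UU cvu ux; have [r bi] := section_split cvu ux.
apply: (@addsubcat_summand _ _ X V U) UU; apply: direct_sum_sym.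
by exists v, x, r, u.
Qed.

End Cotorsion.

Section CotorsionOp.
Variables (B : exact_category) (c : cotorsion_pair B).

Lemma cot_extend (V X Y T : B) (i : hom X Y) (p : hom Y T) (f : hom X V) :
  cotV c V -> cotU c T -> conflation i p -> exists g, g ∘ i = f.
Proof.
move=> VV UT cip.
exact: (@cot_lift (op_exact B) (op_cotorsion c) T Y X V p i f UT VV cip).
Qed.

(** Extend the retraction that splits the conflation over U to all of F, using
    Ext^1(U', V) = 0: the approximation V >-> F ->> E then splits, and E is a
    summand of F. *)
Lemma cotU_extension (U E U' : B) (j : hom U E) (q : hom E U') :
  cotU c U -> cotU c U' -> conflation j q -> cotU c E.
Proof.
move=> UU UU' cjq; have [V [F [i [p [VV UF cip]]]]] := cot_left c E.
have [F' [k ck]] := conflation_comp_out cip cjq.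
have [i' [p' [c' e1 e2]]] := noether_op cip cjq ck.
have [s ps] := cot_lift (idm U) VV UU c'.
have [r [ri _ _ _ _]] := section_split c' ps.
have [r' er'] := cot_extend r VV UU' ck.
have [|x [_ ux _ _ _]] := retraction_split (r := r') cip.
  by rewrite -e2 compA er'.
exact: cotU_of_section UF cip ux.
Qed.

(** The object W lies in V by construction and in U as an extension of U' by
    U. *)
Lemma cotU_to_W (U : B) : cotU c U -> exists (W U' : B) (j : hom U W)
  (k : hom W U'), [/\ cotW c W, cotU c U' & conflation j k].
Proof.
move=> UU; have [W [U' [j [k [VW UU' cjk]]]]] := cot_right c U.
by exists W, U', j, k; split=> //; split=> //; exact: cotU_extension cjk.
Qed.

End CotorsionOp.

Section CotorsionDual.
Variables (B : exact_category) (c : cotorsion_pair B).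

Lemma cotV_extension (V E V' : B) (j : hom V E) (q : hom E V') :
  cotV c V -> cotV c V' -> conflation j q -> cotV c E.
Proof.
move=> VV VV' cjq.
exact: (@cotU_extension (op_exact B) (op_cotorsion c) V' E V q j VV' VV cjq).
Qed.

Lemma W_to_cotV (V : B) : cotV c V -> exists (V' W : B) (j : hom V' W)
  (k : hom W V), [/\ cotV c V', cotW c W & conflation j k].
Proof.
move=> VV; have [W [V' [j [k [[VW UW] VV' cjk]]]]] :=
  @cotU_to_W (op_exact B) (op_cotorsion c) V VV.
by exists V', W, k, j.
Qed.

End CotorsionDual.

Lemma common_pushout (B : exact_category) (X Y Y' K K' : B) (i : hom X Y)
    (p : hom Y K) (i' : hom X Y') (p' : hom Y' K') :
  conflation i p -> conflation i' p' ->
  exists Q (g : hom Y Q) (g' : hom Y' Q) (a : hom Q K') (b : hom Q K),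
    [/\ conflation g a, conflation g' b & g ∘ i = g' ∘ i'].
Proof.
move=> cip cip'; have [Q [a [b [g [g' [pb ca cb _ _]]]]]] :=
  @common_pullback (op_exact B) K K' Y Y' X p i p' i' cip cip'.
by exists Q, g, g', b, a; split=> //; exact: pb.1.
Qed.

(** * The quotient by W and reflections into B^+ *)

Section Null.
Variables (B : exact_category) (c : cotorsion_pair B).

Definition null (X Y : B) (f : hom X Y) : Prop := factors_through (cotW c) f.

Definition quotW : preadditive := ideal_quotient (cotW c).

(** The object part of the quotient functor is the identity; hypotheses are
    kept as null statements, which are self-dual, and equations are computed
    in the quotient. *)
Definition pr (X Y : B) (f : hom X Y) : @hom quotW X Y := quot_pi (cotW c) f.

Lemma prM (X Y Z : B) (g : hom Y Z) (f : hom X Y) :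
  pr (g ∘ f) = pr g ∘ pr f.
Proof. by rewrite /pr /= quot_comp_pi. Qed.

Lemma prD (X Y : B) (f g : hom X Y) : pr (f + g) = pr f + pr g.
Proof. exact: quot_piD. Qed.

Lemma pr0 (X Y : B) : pr (0 : hom X Y) = 0.
Proof. by apply: (addIr (pr 0)); rewrite -prD !add0r. Qed.

Lemma prN (X Y : B) (f : hom X Y) : pr (- f) = - pr f.
Proof. by apply: (addIr (pr f)); rewrite -prD !addNr pr0. Qed.

Lemma prB (X Y : B) (f g : hom X Y) : pr (f - g) = pr f - pr g.
Proof. by rewrite prD prN. Qed.

Lemma prP (X Y : B) (f g : hom X Y) : null (f - g) <-> pr f = pr g.
Proof. exact: (iff_sym (quot_piP (cotW c) f g)). Qed.

Lemma pr_eq0 (X Y : B) (f : hom X Y) : null f <-> pr f = 0.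
Proof. by rewrite -pr0 -prP subr0. Qed.

Lemma null0 (X Y : B) : null (0 : hom X Y).
Proof. by apply/pr_eq0; rewrite pr0. Qed.

Lemma nullD (X Y : B) (f g : hom X Y) : null f -> null g -> null (f + g).
Proof. by rewrite !pr_eq0 prD => -> ->; rewrite addr0. Qed.

Lemma nullN (X Y : B) (f : hom X Y) : null f -> null (- f).
Proof.
by rewrite !pr_eq0 prN => ->; rewrite oppr0.
Qed.

Lemma null_compl (X Y Z : B) (g : hom Y Z) (f : hom X Y) :
  null f -> null (g ∘ f).
Proof. by move=> [T [a [b [WT ->]]]]; exists T, a, (g ∘ b); rewrite compA. Qed.

Lemma null_compr (X Y Z : B) (g : hom Y Z) (f : hom X Y) :
  null g -> null (g ∘ f).
Proof. by move=> [T [a [b [WT ->]]]]; exists T, (a ∘ f), b; rewrite compA. Qed.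

Lemma null_transfer (X Y : B) (f g : hom X Y) :
  null (f - g) -> null f <-> null g.
Proof.
by rewrite !pr_eq0 prB => /eqP; rewrite subr_eq0 => /eqP ->.
Qed.

Lemma minus_null (M V : B) (f : hom M V) : cot_minus c M -> cotV c V -> null f.
Proof.
move=> [W [U [i [p [WW UU cip]]]]] VV; have [g eg] := cot_extend f VV UU cip.
by exists W, i, g.
Qed.

Lemma plus_null (U N : B) (f : hom U N) : cotU c U -> cot_plus c N -> null f.
Proof.
move=> UU [V [W [i [p [VV WW cip]]]]]; have [g eg] := cot_lift f VV UU cip.
by exists W, g, p.
Qed.

(** If N >-> W ->> U', the common pushout Q of Y and W over N is an extension
    of U by W, hence lies in U, and Y embeds in Q with cokernel U'. *)
Lemma minus_extension (N Y U : B) (s : hom N Y) (q : hom Y U) :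
  cot_minus c N -> cotU c U -> conflation s q -> cot_minus c Y.
Proof.
move=> [W [U' [i [p [[UW VW] UU' cip]]]]] UU csq.
have [Q [g [g' [a [b [ca cb _]]]]]] := common_pushout csq cip.
have UQ : cotU c Q by exact: cotU_extension UW UU cb.
have [W' [U2 [j [k [WW' UU2 cjk]]]]] := cotU_to_W UQ.
have [R [t ct]] := conflation_comp_in ca cjk.
have [x [y [cxy _ _]]] := noether ca cjk ct.
by exists W', R, (j ∘ g), t; split=> //; exact: cotU_extension cxy.
Qed.

(** Reflections into B^+ and coreflections into B^- in the quotient B/W, with
    existence and uniqueness of the factorization separated. *)
Definition is_refl (X P : B) (s : hom X P) : Prop :=
  [/\ cot_plus c P,
      forall N, cot_plus c N -> forall a : hom X N, exists b, null (b ∘ s - a)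
    & forall N, cot_plus c N -> forall b : hom P N, null (b ∘ s) -> null b].

Definition is_corefl (Z X : B) (z : hom Z X) : Prop :=
  [/\ cot_minus c Z,
      forall M, cot_minus c M -> forall a : hom M X, exists b, null (z ∘ b - a)
    & forall M, cot_minus c M -> forall b : hom M Z, null (z ∘ b) -> null b].

(** Uniqueness: if b s factors through an object of W, that factorization
    extends over P, so that after a correction b kills X and factors through
    U; and arrows from U to B^+ vanish in the quotient. *)
Lemma refl_of_conflation (X P U : B) (s : hom X P) (q : hom P U) :
  conflation s q -> cotU c U -> cot_plus c P ->
  (forall N, cot_plus c N -> forall a : hom X N, exists b, b ∘ s = a) ->
  is_refl s.
Proof.
move=> csq UU PP ext; split=> // N PN a.
  by have [b <-] := ext N PN a; exists b; rewrite subrr; exact: null0.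
move=> [T [x [y [WT e]]]]; have [x' ex'] := cot_extend x WT.2 UU csq.
have [|g eg] := conf_desc csq (f := a - y ∘ x').
  by rewrite compBl e -compA ex' subrr.
rewrite -[a](subrK (y ∘ x')) -eg; apply: nullD.
  by apply: null_compr; exact: plus_null.
by exists T, x', y.
Qed.

(** An arrow a from X to N in B^+ restricts to U, lifts there to the middle
    term of a conflation V' >-> W' ->> N, and extends to W because U' is in
    the left class; the resulting arrow on W kills V and so descends to P =
    W/V. *)
Lemma refl_of_resolution (V U X W U' P : B) (v : hom V U) (u : hom U X)
    (j : hom U W) (k : hom W U') (t : hom W P) (s : hom X P) :
  cotV c V -> cotU c U -> cotW c W -> cotU c U' ->
  conflation v u -> conflation j k -> conflation (j ∘ v) t -> t ∘ j = s ∘ u ->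
  is_refl s.
Proof.
move=> VV UU WW UU' cvu cjk ct tj.
have [s' [q [csq tj' _]]] := noether cvu cjk ct.
have es : s' = s by apply: (conf_epi cvu); rewrite -tj -tj'.
rewrite es in csq; apply: (refl_of_conflation csq UU').
  by exists V, W, (j ∘ v), t.
move=> N [V' [W' [i [p [VV' WW' cip]]]]] a.
have [x ex] := cot_lift (a ∘ u) VV' UU cip.
have [y ey] := cot_extend x WW'.2 UU' cjk.
have [|b eb] := conf_desc ct (f := p ∘ y).
  by rewrite -compA (compA y) ey compA ex -compA (conf_comp0 cvu) compm0.
exists b; apply: (conf_epi cvu).
by rewrite -compA -tj compA eb -compA ey ex.
Qed.

Lemma exists_refl (X : B) : exists P (s : hom X P), is_refl s.
Proof.
have [V [U [v [u [VV UU cvu]]]]] := cot_left c X.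
have [W [U' [j [k [WW UU' cjk]]]]] := cotU_to_W UU.
have [P [t ct]] := conflation_comp_in cvu cjk.
have [s [q [_ tj _]]] := noether cvu cjk ct.
by exists P, s; exact: (refl_of_resolution VV UU WW UU' cvu cjk ct tj).
Qed.

Lemma refl_unique (X P P' : B) (s : hom X P) (s' : hom X P') :
  is_refl s -> is_refl s' -> exists (f : hom P P') (g : hom P' P),
  [/\ null (f ∘ s - s'), null (g ∘ s' - s) & null (g ∘ f - idm P)].
Proof.
move=> [PP es us] [PP' es' us']; have [f ef] := es _ PP' s'.
have [g eg] := es' _ PP s; exists f, g; split=> //; apply: us => //.
rewrite compBl comp1m -(subrK (g ∘ s') (_ ∘ s)) -addrA; apply: nullD => //.
by rewrite -compA -compBr; exact: null_compl.
Qed.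

(** Since Hom(M, Z) = Hom(M, P) in B/W for M in B^- and Z the coreflection of
    P, this says that f induces a monomorphism in the heart; the intermediate
    object Z can thus be avoided. *)
Definition heart_mono_at (X Y P P' : B) (f : hom X Y)
    (s : hom X P) (s' : hom Y P') (f' : hom P P') : Prop :=
  [/\ is_refl s, is_refl s', null (f' ∘ s - s' ∘ f)
    & forall M, cot_minus c M -> forall m : hom M P, null (f' ∘ m) -> null m].

Definition heart_mono (X Y : B) (f : hom X Y) : Prop :=
  exists P P' (s : hom X P) (s' : hom Y P') f', heart_mono_at f s s' f'.

(** Reflections are unique up to isomorphism in the quotient, so every choice
    of them detects the same property. *)
Lemma heart_mono_any (X Y P P' : B) (f : hom X Y)
    (s : hom X P) (s' : hom Y P') (f' : hom P P') :
  heart_mono f -> is_refl s -> is_refl s' ->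
  null (f' ∘ s - s' ∘ f) -> heart_mono_at f s s' f'.
Proof.
move=> [P0 [P0' [s0 [s0' [f0 [rs0 rs0' ef0 inj]]]]]] rs rs' ef.
split=> // M HM m.
have [a [b [ea eb ba]]] := refl_unique rs rs0.
have [a' [b' [ea' eb' _]]] := refl_unique rs' rs0'.
move=> fm.
have nfa : null (f0 ∘ a - a' ∘ f').
  have [_ _ us] := rs; have [PP0' _ _] := rs0'; apply: us => //.
  move: ea ef0 ea' ef; rewrite compBl !prP !prM => ea ef0 ea' ef.
  by rewrite -!compA ef ea ef0 compA ea'.
have: null (f0 ∘ (a ∘ m)).
  rewrite compA; apply/(@null_transfer _ _ _ (a' ∘ f' ∘ m)).
    by rewrite -compBl; exact: null_compr.
  by rewrite -compA; exact: null_compl.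
move=> /(inj M HM)/(null_compl b); rewrite compA.
apply: (null_transfer _).1; rewrite -[X in _ - X]comp1m -compBl.
exact: null_compr.
Qed.

Lemma heart_mono_comp (X Y Z : B) (g : hom Y Z) (f : hom X Y) :
  heart_mono g -> heart_mono f -> heart_mono (g ∘ f).
Proof.
move=> [Q [R [s2 [s3 [g' [rs2 rs3 eg injg]]]]]].
move=> hf; have [P [Q1 [s1 [s2' [_ [rs1 _ _ _]]]]]] := hf.
have [QP _ _] := rs2; have [_ es _] := rs1.
have [f' ef] := es _ QP (s2 ∘ f).
have [_ _ _ injf] := heart_mono_any hf rs1 rs2 ef.
exists P, R, s1, s3, (g' ∘ f'); split=> //.
  by move: ef eg; rewrite !prP !prM => ef eg; rewrite -compA ef compA eg compA.
by move=> M MM m; rewrite -compA => /(injg M MM)/(injf M MM).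
Qed.

Lemma heart_mono_retraction (X Y : B) (f : hom X Y) (r : hom Y X) :
  r ∘ f = idm X -> heart_mono f.
Proof.
move=> rf; have [P [s rs]] := exists_refl X; have [Q [t rt]] := exists_refl Y.
have [PP es us] := rs; have [QP et ut] := rt.
have [f' ef] := es _ QP (t ∘ f); have [r' er] := et _ PP (s ∘ r).
exists P, Q, s, t, f'; split=> // M MM m /(null_compl r'); rewrite compA.
apply: (null_transfer _).1; rewrite -[X in _ - X]comp1m -compBl.
apply: null_compr; apply: us => //; move: ef er.
rewrite compBl !prP !prM => ef er.
by rewrite -compA ef compA er -compA -prM rf compm1 comp1m.
Qed.

End Null.

(** * Morphisms that become monic in the heart *)

Section HMono.
Variables (B : exact_category) (c : cotorsion_pair B).

(** The reflections of D and E are built from compatible resolutions: U_D is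
    the pullback of D and U_E over E, and W' contains the pushout Q of W and
    U_E over U_D. The reflections become the quotients of W and W' by the same
    V, so that W is the pullback of W' along f. An arrow M -> P_D that dies in
    P_E modulo W has its composite to P_E lifted to W', hence itself factors
    through W. *)
Lemma heart_mono_cotU (U0 D E : B) (d : hom U0 D) (e : hom D E) :
  conflation d e -> cotU c U0 -> heart_mono c e.
Proof.
move=> cde UU0; have [V [UE [v [u [VV UUE cvu]]]]] := cot_left c E.
have [UD [a [b [g [g' [pb cag cbg ga gb]]]]]] := common_pullback cde cvu.
have UUD : cotU c UD by exact: cotU_extension UU0 UUE cag.
have [W [U1 [j [k [WW UU1 cjk]]]]] := cotU_to_W UUD.
have [PD [t ct]] := conflation_comp_in cbg cjk.
have [s [q [_ tj _]]] := noether cbg cjk ct.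
have [Q [r cr]] := conflation_comp_in cag cjk.
have [s2 [q2 [cs2 rj _]]] := noether cag cjk cr.
have UQ : cotU c Q by exact: cotU_extension UUE UU1 cs2.
have [W' [U3 [j' [k' [WW' UU3 cjk']]]]] := cotU_to_W UQ.
have [U4 [t2 ct2]] := conflation_comp_in cs2 cjk'.
have [x2 [y2 [cxy2 _ _]]] := noether cs2 cjk' ct2.
have UU4 : cotU c U4 by exact: cotU_extension UU1 UU3 cxy2.
have [PE [t' ct']] := conflation_comp_in cvu ct2.
have [s' [q' [_ tj' _]]] := noether cvu ct2 ct'.
have wjb : j' ∘ r ∘ (j ∘ b) = j' ∘ s2 ∘ v.
  by rewrite -(compA j') (compA r) rj -!compA gb.
have [|f ef] := conf_desc ct (f := t' ∘ (j' ∘ r)).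
  by rewrite -compA wjb (conf_comp0 ct').
exists PD, PE, s, s', f; split.
- exact: (refl_of_resolution VV UUD WW UU1 cbg cjk ct tj).
- exact: (refl_of_resolution VV UUE WW' UU4 cvu ct2 ct' tj').
- apply/prP; congr (pr c _); apply: (conf_epi cbg).
  by rewrite -compA -tj compA ef -!compA rj pb.1 !(compA s') -tj' !compA.
- move=> M _ m [T [x [y [WT exy]]]].
  have [y' ey] := cot_lift y VV WT.1 ct'.
  have [|z [<- _]] := weak_pullback (m := m) (n := y' ∘ x)
    ct ct' wjb (esym ef); first by rewrite exy compA ey.
  by exists W, z, t.
Qed.

(** The same U_E and W resolve both E and Y, with V_Y an extension of V0 by
    V_E. The reflection of Y is then the quotient of that of E by V0, and
    arrows from B^- to V0 vanish in the quotient. *)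
Lemma heart_mono_cotV (V0 E Y : B) (i : hom V0 E) (p : hom E Y) :
  conflation i p -> cotV c V0 -> heart_mono c p.
Proof.
move=> cip VV0; have [V [UE [v [u [VV UUE cvu]]]]] := cot_left c E.
have [VY [k ck]] := conflation_comp_out cvu cip.
have [i' [p' [cip' uk ki]]] := noether_op cvu cip ck.
have VVY : cotV c VY by exact: cotV_extension VV VV0 cip'.
have [W [U1 [j [k1 [WW UU1 cjk]]]]] := cotU_to_W UUE.
have [PY [tY ctY]] := conflation_comp_in ck cjk.
have [PE [tE ctE]] := conflation_comp_in cip' ctY.
have [x [f [cxf _ ef]]] := noether cip' ctY ctE.
rewrite -compA ki in ctE.
have [sE [_ [_ tjE _]]] := noether cvu cjk ctE.
have [sY [_ [_ tjY _]]] := noether ck cjk ctY.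
exists PE, PY, sE, sY, f; split.
- exact: (refl_of_resolution VV UUE WW UU1 cvu cjk ctE tjE).
- exact: (refl_of_resolution VVY UUE WW UU1 ck cjk ctY tjY).
- apply/prP; congr (pr c _); apply: (conf_epi cvu).
  by rewrite -compA -tjE compA ef tjY compA.
- move=> M MM m [T [y [z [WT eyz]]]].
  have [z' ez] := cot_lift z VVY WT.1 ctY.
  have [|n en] := conf_lift cxf (f := m - tE ∘ (z' ∘ y)).
    by rewrite compBr eyz !compA ef ez subrr.
  apply: (null_transfer _).2 (_ : null c (tE ∘ (z' ∘ y))).
    by rewrite -en; apply: null_compl; exact: minus_null MM VV0.
  by exists T, y, (tE ∘ z'); rewrite compA.
Qed.

(** Modulo the complement of X in G, f is a deflation with kernel in K. Only K
    occurs, not the cotorsion pair: this is what transports the notion from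
    one pair to the other. *)
Definition Kmono (X Y : B) (f : hom X Y) : Prop :=
  exists (A G : B) (a : hom A G) (b : hom G Y) (i : hom X G) (r : hom G X),
  [/\ cotK c A, conflation a b, r ∘ i = idm X & b ∘ i = f].

(** Enlarging G makes the kernel an extension of V by U, and b is then the
    deflation by U followed by the deflation by V. *)
Lemma Kmono_heart_mono (X Y : B) (f : hom X Y) : Kmono f -> heart_mono c f.
Proof.
move=> [A [G [a [b [i [r [KA cab ri <-]]]]]]].
have [A' [S [sS [U [V [d [e [UU VV cde]]]]]]]] := KA.
have [i1 [i2 [p1 [p2 biS]]]] := sS.
have [G' [j1 [q1 [a' [b' [qj cab' <-]]]]]] := add_summand biS cab.
have [E [x cx]] := conflation_comp_in cde cab'.
have [s [q [csq _ <-]]] := noether cde cab' cx.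
have hr : heart_mono c (j1 ∘ i).
  apply: (@heart_mono_retraction _ _ _ _ _ (r ∘ q1)).
  by rewrite compA -(compA r) qj compm1.
rewrite -!compA; apply: heart_mono_comp (heart_mono_cotV csq VV) _.
exact: heart_mono_comp (heart_mono_cotU cx UU) hr.
Qed.

End HMono.

(** * Cokernels of epimorphisms *)

Section Coker.
Variables (B : exact_category) (c : cotorsion_pair B).

Definition plus_epi (X Y : B) (h : hom X Y) : Prop :=
  forall L, cot_plus c L -> forall n : hom Y L, null c (n ∘ h) -> null c n.

Definition minus_mono (X Y : B) (h : hom X Y) : Prop :=
  forall L, cot_minus c L -> forall n : hom L X, null c (h ∘ n) -> null c n.

(** The case to have in mind is C the cokernel of M -> N (+) W. Being epi, h
    forces the reflection s2 : C -> P to vanish in the quotient, and even to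
    lift to W2; since U_C is the pullback of W2 and C over P, the cover U_C
    ->> C then has a section. *)
Lemma plus_epi_cokernel (M N W U C : B) (h : hom M N) (i : hom M W)
    (p : hom W U) (s : hom N C) (q : hom C U) (t : hom W C) :
  plus_epi h -> cotW c W -> cotU c U -> conflation i p -> conflation s q ->
  t ∘ i = s ∘ h -> cotU c C.
Proof.
move=> epi WW UU cip csq ti.
have [V [UC [v [u [VV UUC cvu]]]]] := cot_left c C.
have [W2 [U2 [j [k [WW2 UU2 cjk]]]]] := cotU_to_W UUC.
have [P [t2 ct2]] := conflation_comp_in cvu cjk.
have [s2 [q2 [_ tj2 _]]] := noether cvu cjk ct2.
have [||T [x [y [WT exy]]]] := epi P _ (s2 ∘ s) _.
- by exists V, W2, (j ∘ v), t2.
- by rewrite -compA -ti compA; exists W, i, (s2 ∘ t).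
have [x' ex] := cot_extend x WT.2 UU csq.
have [|z ez] := conf_desc csq (f := s2 - y ∘ x').
  by rewrite compBl exy -compA ex subrr.
have [z' ez'] := cot_lift z VV UU ct2.
have [y' ey] := cot_lift y VV WT.1 ct2.
have [|w [uw _]] := weak_pullback (m := idm C) (n := y' ∘ x' + z' ∘ q)
  cvu ct2 (erefl _) tj2.
  by rewrite compm1 compDr !compA ey ez' ez addrC subrK.
exact: cotU_of_section UUC cvu uw.
Qed.

End Coker.

(** * The dual results *)

Section Dual.
Variables (B : exact_category) (c : cotorsion_pair B).

(** The intersection of the two classes is the same for the opposite cotorsion
    pair, up to the order of the conjunction. *)
Lemma null_op (X Y : B) (f : hom X Y) :
  null c f <-> @null (op_exact B) (op_cotorsion c) Y X f.
Proof. by split=> -[T [a [b [[UT VT] e]]]]; exists T, b, a. Qed.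

Lemma cot_plus_op (X : B) :
  cot_plus c X <-> @cot_minus (op_exact B) (op_cotorsion c) X.
Proof.
by split=> -[Y [Z [i [p]]]] => [[VV [? ?]] cip|[[? ?] VV cip]];
   exists Z, Y, p, i.
Qed.

Lemma cot_minus_op (X : B) :
  cot_minus c X <-> @cot_plus (op_exact B) (op_cotorsion c) X.
Proof.
by split=> -[Y [Z [i [p]]]] => [[[? ?] VV cip]|[VV [? ?]] cip];
   exists Z, Y, p, i.
Qed.

Lemma cotK_op (X : B) : cotK c X <-> @cotK (op_exact B) (op_cotorsion c) X.
Proof.
split=> -[Y [S [/direct_sum_op sS [U [V [i [p [UU VV cip]]]]]]]];
  by exists Y, S; split=> //; exists V, U, p, i.
Qed.

Lemma corefl_op (Z X : B) (z : hom Z X) :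
  is_corefl c z <-> @is_refl (op_exact B) (op_cotorsion c) X Z z.
Proof.
split=> -[]; [move=> /cot_minus_op ZM ez uz|move=> /cot_minus_op ZM ez uz].
  split=> // [N /cot_minus_op NM a|N /cot_minus_op NM b].
    by have [b /null_op eb] := ez N NM a; exists b.
  by move=> /null_op zb; apply/null_op; exact: (uz N NM).
split=> // [N /cot_minus_op NM a|N /cot_minus_op NM b].
  by have [b /null_op eb] := ez N NM a; exists b.
by move=> /null_op zb; apply/null_op; exact: (uz N NM).
Qed.

Lemma plus_extension (V Y N : B) (s : hom V Y) (q : hom Y N) :
  cot_plus c N -> cotV c V -> conflation s q -> cot_plus c Y.
Proof.
move=> /cot_plus_op PN VV csq; apply/cot_plus_op.
exact: (@minus_extension (op_exact B) (op_cotorsion c) N Y V q s PN VV csq).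
Qed.

Lemma corefl_of_conflation (Z X V : B) (i : hom V Z) (z : hom Z X) :
  conflation i z -> cotV c V -> cot_minus c Z ->
  (forall M, cot_minus c M -> forall a : hom M X, exists b, z ∘ b = a) ->
  is_corefl c z.
Proof.
move=> ciz VV /cot_minus_op ZM ext; apply/corefl_op.
apply: (@refl_of_conflation (op_exact B) (op_cotorsion c) X Z V z i) => //.
by move=> N /cot_minus_op NM a; exact: ext.
Qed.

Lemma corefl_of_resolution (U V X W V' Z : B) (v : hom V U) (u : hom X V)
    (j : hom W V) (k : hom V' W) (t : hom Z W) (z : hom Z X) : 
  cotU c U -> cotV c V -> cotW c W -> cotV c V' ->
  conflation u v -> conflation k j -> conflation t (v ∘ j) -> j ∘ t = u ∘ z ->
  is_corefl c z.
Proof.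
move=> UU VV [UW VW] VV' cuv ckj ct e; apply/corefl_op.
exact: (@refl_of_resolution (op_exact B) (op_cotorsion c) U V X W V' Z
  v u j k t z UU VV (conj VW UW) VV' cuv ckj ct e).
Qed.

Lemma minus_mono_kernel (M N W V K : B) (h : hom M N) (p : hom W N)
    (i : hom V W) (q : hom K M) (s : hom V K) (t : hom K W) :
  minus_mono c h -> cotW c W -> cotV c V -> conflation i p -> conflation s q ->
  p ∘ t = h ∘ q -> cotV c K.
Proof.
move=> mono [UW VW] VV cip csq e.
apply: (@plus_epi_cokernel (op_exact B) (op_cotorsion c) N M W V K h p i q s t).
- by move=> L /cot_minus_op ML n /null_op/(mono L ML)/null_op.
- by split.
- exact: VV.
- exact: cip.
- exact: csq.
- exact: e.
Qed.

Definition heart_epi_at (X Y Z Z' : B) (f : hom X Y)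
    (z : hom Z X) (z' : hom Z' Y) (f' : hom Z Z') : Prop :=
  [/\ is_corefl c z, is_corefl c z', null c (z' ∘ f' - f ∘ z)
    & plus_epi c f'].

Definition heart_epi (X Y : B) (f : hom X Y) : Prop :=
  exists Z Z' (z : hom Z X) (z' : hom Z' Y) f', heart_epi_at f z z' f'.

Lemma heart_epi_at_op (X Y Z Z' : B) (f : hom X Y) (z : hom Z X) (z' : hom Z' Y)
    (f' : hom Z Z') : heart_epi_at f z z' f' <->
  @heart_mono_at (op_exact B) (op_cotorsion c) Y X Z' Z f z' z f'.
Proof.
split=> -[/corefl_op rz /corefl_op rz' /null_op e inj]; split=> //.
- by move=> M /cot_plus_op PM m /null_op/(inj M PM)/null_op.
- by move=> M /cot_plus_op PM m /null_op/(inj M PM)/null_op.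
Qed.

Lemma heart_epi_op (X Y : B) (f : hom X Y) :
  heart_epi f <-> @heart_mono (op_exact B) (op_cotorsion c) Y X f.
Proof.
by split=> -[Z [Z' [z [z' [f' /heart_epi_at_op h]]]]]; exists Z', Z, z', z, f'.
Qed.

Lemma heart_epi_any (X Y Z Z' : B) (f : hom X Y) (z : hom Z X) (z' : hom Z' Y)
    (f' : hom Z Z') : heart_epi f -> is_corefl c z -> is_corefl c z' ->
  null c (z' ∘ f' - f ∘ z) -> heart_epi_at f z z' f'.
Proof.
move=> /heart_epi_op hf /corefl_op rz /corefl_op rz' /null_op e.
by apply/heart_epi_at_op; apply: heart_mono_any.
Qed.

(** The dual of Kmono. *)
Definition Kepi (X Y : B) (f : hom X Y) : Prop :=
  exists (A G : B) (a : hom G A) (b : hom X G) (i : hom Y G) (r : hom G Y),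
  [/\ cotK c A, conflation b a, r ∘ i = idm Y & r ∘ b = f].

Lemma Kepi_heart_epi (X Y : B) (f : hom X Y) : Kepi f -> heart_epi f.
Proof.
move=> [A [G [a [b [i [r [/cotK_op KA cba ri rb]]]]]]].
by apply/heart_epi_op; apply: Kmono_heart_mono; exists A, G, a, b, r, i.
Qed.

End Dual.

(** * The heart is balanced *)

Section Balanced.
Variables (B : exact_category) (c : cotorsion_pair B).

(** Adding to M the object W of a conflation V >-> W ->> N turns h, up to
    sign, into a deflation d : G ->> N with kernel K; as h is monic, K lies in
    V. As h is epic, the cokernel C of G -> N (+) W' lies in U. So K >-> W'
    ->> C splits, and since G is the pullback of W' and N over C, d has a
    section. *)
Lemma heart_balanced (M N : B) (h : hom M N) :
  cot_minus c M -> cot_plus c N -> minus_mono c h -> plus_epi c h ->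
  exists g, null c (g ∘ h - idm M) /\ null c (h ∘ g - idm N).
Proof.
move=> MM PN mono epi; have [V [W [v [w [VV WW cvw]]]]] := PN.
have [K [v' [q [t [pb cvq tv]]]]] := base_change h cvw.
have VK : cotV c K by apply: minus_mono_kernel mono WW VV cvw cvq pb.1.
have [G [i1 [i2 [p1 [p2 [a [d [bi cad [di1 di2] _]]]]]]]] :=
  bicartesian_op cvq cvw tv pb.1.
have MG : cot_minus c G.
  exact: minus_extension MM WW.1 (biproduct_conflation bi).
have [W' [U [g1 [g2 [WW' UU cg]]]]] := MG.
have [C [t' ct']] := conflation_comp_in cad cg.
have [s [q' [csq tg _]]] := noether cad cg ct'.
have UC : cotU c C.
  apply: plus_epi_cokernel WW' UU cg csq tg => L PL n /(null_compr i1).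
  rewrite -compA di1 compmN => /nullN; rewrite opprK; exact: epi.
have [x tx] := cot_lift (idm C) VK UC ct'.
have [|y [dy _]] := weak_pullback (m := idm N) (n := x ∘ s)
  cad ct' (erefl _) tg; first by rewrite compm1 compA tx comp1m.
have nhg : null c (h ∘ - (p1 ∘ y) - idm N).
  have [_ _ _ _ e] := bi; rewrite -dy -[in X in _ - X](comp1m y) -e.
  rewrite compDl compDr !compA di1 di2 compmN compNm opprD addrA.
  rewrite compNm compA subrr add0r.
  by apply/nullN; exists W, (p2 ∘ y), w; rewrite compA.
exists (- (p1 ∘ y)); split=> //; apply: mono => //.
by rewrite compBr compm1 compA -[X in _ - X]comp1m -compBl; exact: null_compr.
Qed.

End Balanced.

(** * Reflection followed by coreflection *)

Section Datum.
Variables (B : exact_category) (c : cotorsion_pair B).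

(** Such morphisms become invertible in the heart, by balancedness. *)
Definition Kiso (X Y : B) (f : hom X Y) : Prop := Kmono c f /\ Kepi c f.

Lemma cotU_sub_cotK (U : B) : cotU c U -> cotK c U.
Proof.
move=> UU; have [Z [q cq]] := inflation_id U.
have Z0 : is_zero_object Z.
  have q0 : q = 0 by rewrite -[q]compm1 (conf_comp0 cq).
  have id0 : idm Z = 0 by apply: (conf_epi cq); rewrite q0 !compm0.
  split=> X f; first by rewrite -[f]compm1 id0 compm0.
  by rewrite -[f]comp1m id0 comp0m.
exists Z, U; split; last first.
  by exists U, Z, (idm U), q; split=> //; exact: addsubcat0.
exists (idm U), 0, (idm U), 0; split.
- exact: compm1.
- by rewrite (Z0.1 _ (idm Z)) (Z0.1 _ (_ ∘ _)).
- exact: compm1.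
- exact: comp1m.
- by rewrite compm1 compm0 addr0.
Qed.

(** The square r, s, z, p gives one object of the heart that is at once the
    reflection of the coreflection of X and the coreflection of its
    reflection: the first property controls arrows out of it, the second
    arrows into it. *)
Record heart_datum (X : B) := HeartDatum {
  hd_plus : B;
  hd_minus : B;
  hd_heart : B;
  hd_s : hom X hd_plus;
  hd_p : hom hd_minus X;
  hd_r : hom hd_minus hd_heart;
  hd_z : hom hd_heart hd_plus;
  hd_comm : hd_z ∘ hd_r = hd_s ∘ hd_p;
  hd_sP : is_refl c hd_s;
  hd_pP : is_corefl c hd_p;
  hd_rP : is_refl c hd_r;
  hd_zP : is_corefl c hd_z;
  hd_sK : Kiso hd_s;
  hd_zK : Kiso hd_z }.

End Datum.

Section ExistsDatum.
Variables (B : exact_category) (c : cotorsion_pair B).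

Lemma cotV_sub_cotK (V : B) : cotV c V -> cotK c V.
Proof.
move=> VV; apply/cotK_op.
exact: (@cotU_sub_cotK (op_exact B) (op_cotorsion c)).
Qed.

(** Take X >-> P ->> U' for the reflection and X >-> V1 ->> U1 with V' >-> W'
    ->> V1. The inflation x of X into V1 extends to x' on P, and Z is the
    pullback of W' along x'; the coreflection M is the pullback of W' along x.
    Thus Z ->> P has kernel V', while M >-> Z has cokernel U', which yields
    both universal properties. Each of s and z is one side of a bicartesian
    square whose other corners lie in U or V. *)
Lemma exists_heart_datum (X : B) : exists d : heart_datum c X, True.
Proof.
have [V [U [v [u [VV UU cvu]]]]] := cot_left c X.
have [W [U' [j [k [WW UU' cjk]]]]] := cotU_to_W UU.
have [P [t ct]] := conflation_comp_in cvu cjk.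
have [s [q [csq tj qt]]] := noether cvu cjk ct.
have [V1 [U1 [x [y [VV1 UU1 cxy]]]]] := cot_right c X.
have [V' [W' [v' [w' [VV' WW' cvw]]]]] := W_to_cotV VV1.
have [M [m cm]] := conflation_comp_out cvw cxy.
have [i [p [cip wm mi]]] := noether_op cvw cxy cm.
have [x' ex'] := cot_extend x VV1 UU' csq.
have [Z [iz [z [f [pb cz fiz]]]]] := base_change x' cvw.
have PP : cot_plus c P by exists V, W, (j ∘ v), t.
have MM : cot_minus c M by exists W', U1, m, (y ∘ w').
have [|r [[fr zr] _]] := pb.2 M m (s ∘ p); first by rewrite compA ex'.
have cr : conflation r (q ∘ z).
  apply: conflation_of_kernel.
    by apply: deflation_comp; [exists V', iz | exists X, s].
  split=> [|T g]; first by rewrite -compA zr compA (conf_comp0 csq) comp0m.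
  rewrite -compA => /(conf_lift csq)[h eh].
  (* M is the pullback of w' along x, by its description as a kernel. *)
  have wfg : w' ∘ (f ∘ g) = x ∘ h by rewrite compA pb.1 -compA -eh compA ex'.
  have [|l el] := conf_lift cm (f := f ∘ g).
    by rewrite -compA wfg compA (conf_comp0 cxy) comp0m.
  exists l; split=> [|l' el']; last first.
    by apply: (conf_mono cm); rewrite el -el' compA fr.
  apply: (pullback_inj pb); first by rewrite compA fr.
  rewrite compA zr -eh -compA; congr (comp _ _); apply: (conf_mono cxy).
  by rewrite compA -wm -compA el.
have ZM : cot_minus c Z by exact: minus_extension MM UU' cr.
have ZP : cot_plus c Z by exact: plus_extension PP VV' cz.
have sP : is_refl c s by exact: (refl_of_resolution VV UU WW UU' cvu cjk ct tj).
have pP : is_corefl c p.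
  exact: (corefl_of_resolution UU1 VV1 WW' VV' cxy cvw cm wm).
have zP : is_corefl c z.
  apply: (corefl_of_conflation cz VV' ZM) => L LM a.
  have [W0 [U0 [i0 [p0 [WW0 UU0 c0]]]]] := LM.
  have [g eg] := cot_extend (x' ∘ a) VV1 UU0 c0.
  have [g' eg'] := cot_lift g VV' WW0.1 cvw.
  have [|l [[_ el] _]] := pb.2 L (g' ∘ i0) a; first by rewrite compA eg'.
  by exists l.
have rP : is_refl c r.
  apply: (refl_of_conflation cr UU' ZP) => N NP a.
  have [V0 [W0 [i0 [p0 [VV0 WW0 c0]]]]] := NP.
  have [u' eu'] := cot_lift u VV' UU cip.
  have [e ee] := cot_lift (a ∘ u') VV0 UU c0.
  have [e' ee'] := cot_extend e WW0.2 UU' cjk.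
  have [t' et'] := cot_lift t VV' WW.1 cz.
  (* Correct the lift t' of t so that it agrees with r u' on U. *)
  have [|d ed] := conf_lift cz (f := t' ∘ j - r ∘ u').
    by rewrite compBr !compA et' zr -compA eu' tj subrr.
  have [d' ed'] := cot_extend d VV' UU' cjk.
  have [||| b [eb _]] := weak_pushout (f := u') (g := t' - iz ∘ d') (m := a)
    (n := p0 ∘ e') cjk cr.
  - by rewrite compBr -!compA et' (compA z) (conf_comp0 cz) comp0m compm0 subr0.
  - by rewrite compBl -compA ed' ed subKr.
  - by rewrite -compA ee' ee.
  by exists b.
have sK : Kiso c s.
  have [G [i1 [i2 [p1 [p2 [a [b [[e1 _ _ _ _] cab [bi1 _] _]]]]]]]] :=
    bicartesian cjk csq tj qt.
  split; first by exists U, G, a, b, i1, p1; split=> //; exact: cotU_sub_cotK.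
  exists U', P, q, s, (idm P), (idm P); rewrite !comp1m; split=> //.
  exact: cotU_sub_cotK.
have zK : Kiso c z.
  have [G [i1 [i2 [p1 [p2 [a [b [[e1 _ _ _ _] cab _ [pa1 _]]]]]]]]] :=
    bicartesian_op cz cvw fiz pb.1.
  split; last by exists V1, G, b, a, i1, p1; split=> //; exact: cotV_sub_cotK.
  exists V', Z, iz, z, (idm Z), (idm Z); rewrite !compm1; split=> //.
  exact: cotV_sub_cotK.
by exists (HeartDatum zr sP pP rP zP sK zK).
Qed.

End ExistsDatum.

(** * The functor to the heart *)

Section HeartMap.
Variables (B : exact_category) (c : cotorsion_pair B).

Definition datum (X : B) : heart_datum c X :=
  projT1 (cid (exists_heart_datum c X)).

Notation P X := (hd_plus (datum X)).
Notation M X := (hd_minus (datum X)).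
Notation Z X := (hd_heart (datum X)).
Notation s X := (hd_s (datum X)).
Notation p X := (hd_p (datum X)).
Notation r X := (hd_r (datum X)).
Notation z X := (hd_z (datum X)).

Lemma plus_P X : cot_plus c (P X). Proof. by case: (hd_sP (datum X)). Qed.
Lemma minus_M X : cot_minus c (M X). Proof. by case: (hd_pP (datum X)). Qed.
Lemma plus_Z X : cot_plus c (Z X). Proof. by case: (hd_rP (datum X)). Qed.
Lemma minus_Z X : cot_minus c (Z X). Proof. by case: (hd_zP (datum X)). Qed.

(** The relation defining the functor on arrows: f passes to reflections, and
    that arrow lifts to coreflections. Working with a relation lets every lift
    be chosen freely. *)
Definition heart_rel (X Y : B) (f : hom X Y) (h : hom (Z X) (Z Y)) : Prop :=
  exists f' : hom (P X) (P Y),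
    null c (f' ∘ s X - s Y ∘ f) /\ null c (z Y ∘ h - f' ∘ z X).

Lemma heart_rel_ex (X Y : B) (f : hom X Y) : exists h, heart_rel f h.
Proof.
have [_ es _] := hd_sP (datum X); have [_ ez _] := hd_zP (datum Y).
have [f' ef] := es _ (plus_P Y) (s Y ∘ f).
have [h eh] := ez _ (minus_Z X) (f' ∘ z X).
by exists h, f'.
Qed.

Lemma heart_rel_id (X : B) : heart_rel (idm X) (idm (Z X)).
Proof.
by exists (idm _); rewrite !comp1m !compm1 !subrr; split; exact: null0.
Qed.

Lemma heart_rel_comp (X Y T : B) (g : hom Y T) (f : hom X Y) h k :
  heart_rel f h -> heart_rel g k -> heart_rel (g ∘ f) (k ∘ h).
Proof.
move=> [f' [e1 e2]] [g' [e3 e4]]; exists (g' ∘ f').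
move: e1 e2 e3 e4; rewrite !prP !prM => e1 e2 e3 e4; split.
  by rewrite -compA e1 compA e3 compA.
by rewrite compA e4 -compA e2 compA.
Qed.

Lemma heart_rel_sub (X Y : B) (f g : hom X Y) h k :
  heart_rel f h -> heart_rel g k -> heart_rel (f - g) (h - k).
Proof.
move=> [f' [e1 e2]] [g' [e3 e4]]; exists (f' - g').
move: e1 e2 e3 e4; rewrite !prP !compBl !compBr !prB => -> -> -> ->.
by [].
Qed.

Lemma heart_rel_null (X Y : B) (f : hom X Y) h :
  null c f -> heart_rel f h -> null c h.
Proof.
move=> nf [f' [e1 e2]].
have [_ _ us] := hd_sP (datum X); have [_ _ uz] := hd_zP (datum Y).
have nf' : null c f'.
  apply: us; first exact: plus_P.
  by apply: (null_transfer e1).2; exact: null_compl.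
apply: uz; first exact: minus_Z.
by apply: (null_transfer e2).2; exact: null_compr.
Qed.

(** For A in K the arrow A -> 0 is a deflation with kernel in K, hence becomes
    monic in the heart. *)
Lemma heart_cotK (A : B) : cotK c A -> null c (idm (Z A)).
Proof.
move=> KA; have [O [q cq]] := inflation_id A.
have q0 : q = 0 by rewrite -[q]compm1 (conf_comp0 cq).
have hq : heart_mono c q.
  apply: Kmono_heart_mono; exists A, A, (idm A), q, (idm A), (idm A).
  by rewrite !compm1; split.
have [_ _ uz] := hd_zP (datum A).
apply: (uz _ (minus_Z A)); rewrite compm1.
have [_ _ _ inj] := heart_mono_any (f' := 0) hq
  (hd_sP (datum A)) (hd_sP (datum O))
  ltac:(by rewrite q0 comp0m compm0 subrr; exact: null0).
by apply: inj (minus_Z A) _ _; rewrite comp0m; exact: null0.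
Qed.

Definition factors_K (X Y : B) (f : hom X Y) : Prop :=
  exists (A : B) (a : hom X A) (b : hom A Y), cotK c A /\ f = b ∘ a.

Lemma heart_rel_K (X Y : B) (f : hom X Y) h :
  factors_K f -> heart_rel f h -> null c h.
Proof.
move=> [A [a [b [KA ->]]]] hf.
have [ha ea] := heart_rel_ex a; have [hb eb] := heart_rel_ex b.
have hh := heart_rel_sub hf (heart_rel_comp ea eb); rewrite subrr in hh.
apply: (null_transfer (heart_rel_null _ hh)).2; first exact: null0.
rewrite -[ha]comp1m; apply/null_compl/null_compr; exact: heart_cotK.
Qed.

(** Monicity is read off through Z -> P, epicity through M -> Z. *)
Lemma heart_rel_iso (X Y : B) (f : hom X Y) h :
  Kiso c f -> heart_rel f h -> is_iso (pr c h).
Proof.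
move=> [/Kmono_heart_mono mf /Kepi_heart_epi ef] [f' [e1 e2]].
have [_ _ _ injf] := heart_mono_any mf (hd_sP (datum X)) (hd_sP (datum Y)) e1.
have [_ ep _] := hd_pP (datum Y); have [_ _ uzX] := hd_zP (datum X).
have [_ _ uzY] := hd_zP (datum Y); have [_ _ ur] := hd_rP (datum Y).
have [g e3] := ep _ (minus_M X) (f ∘ p X).
have [_ _ _ epif] := heart_epi_any ef (hd_pP (datum X)) (hd_pP (datum Y)) e3.
have e4 : null c (h ∘ r X - r Y ∘ g).
  apply: (uzY _ (minus_M X)); move: e1 e2 e3.
  rewrite compBr !compA !hd_comm !prP !prM => e1 e2 e3.
  by rewrite e2 -compA -prM hd_comm prM compA e1 -!compA e3.
have [|| k [kh hk]] := heart_balanced (h := h) (minus_Z X) (plus_Z Y).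
- move=> L ML n /(null_compl (z Y)); rewrite compA => n1.
  apply: (uzX _ ML); apply: (injf _ ML); rewrite compA.
  apply: (null_transfer _).1 n1; rewrite -compBl; exact: null_compr.
- move=> L PL n /(null_compr (r X)); rewrite -compA => n1.
  apply: (ur _ PL); apply: (epif _ PL); rewrite -compA.
  apply: (null_transfer _).1 n1; rewrite -compBr; exact: null_compl.
by exists (pr c k); rewrite -!prM; split; apply/prP.
Qed.

Definition heart_map (X Y : B) (f : hom X Y) : @hom (quotW c) (Z X) (Z Y) :=
  pr c (projT1 (cid (heart_rel_ex f))).

Lemma heart_map_rel (X Y : B) (f : hom X Y) :
  exists2 h, heart_rel f h & heart_map f = pr c h.
Proof. by exists (projT1 (cid (heart_rel_ex f))) => //; exact: projT2. Qed.

Lemma heart_map_eq (X Y : B) (f g : hom X Y) :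
  factors_K (f - g) -> heart_map f = heart_map g.
Proof.
move=> Kfg; have [h hf ->] := heart_map_rel f.
have [k kg ->] := heart_map_rel g.
by apply/prP; exact: heart_rel_K Kfg (heart_rel_sub hf kg).
Qed.

Lemma heart_mapE (X Y : B) (f : hom X Y) h :
  heart_rel f h -> heart_map f = pr c h.
Proof.
move=> hf; have [k kf ->] := heart_map_rel f; apply/prP.
by apply: heart_rel_null (heart_rel_sub kf hf); rewrite subrr; exact: null0.
Qed.

Lemma heart_map_id (X : B) : heart_map (idm X) = idm _.
Proof. by rewrite (heart_mapE (heart_rel_id X)). Qed.

Lemma heart_map_comp (X Y T : B) (g : hom Y T) (f : hom X Y) :
  heart_map (g ∘ f) = heart_map g ∘ heart_map f.
Proof.
have [h hf ->] := heart_map_rel f; have [k kg ->] := heart_map_rel g.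
by rewrite -prM (heart_mapE (heart_rel_comp hf kg)).
Qed.

Lemma heart_map_iso (X Y : B) (f : hom X Y) : Kiso c f -> is_iso (heart_map f).
Proof.
by move=> Kf; have [h hf ->] := heart_map_rel f; exact: heart_rel_iso hf.
Qed.

(** An object of B^+ is its own reflection, and one of B^- its own
    coreflection. *)
Lemma heart_map_on_heart (X : B) : cotH c X ->
  exists e : hom (Z X) X, null c (s X ∘ e - z X) /\ is_iso (pr c e).
Proof.
move=> [PX MX]; have [_ es us] := hd_sP (datum X).
have [_ ez uz] := hd_zP (datum X).
have [s' e1] := es _ PX (idm X); have [g e2] := ez _ MX (s X).
have e3 : null c (s X ∘ (s' ∘ z X) - z X).
  rewrite compA -[X in _ - X]comp1m -compBl; apply/null_compr.
  apply: (us _ (plus_P X)); rewrite compBl comp1m -compA -[X in _ - X]compm1.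
  by rewrite -compBr; exact: null_compl.
exists (s' ∘ z X); split=> //; exists (pr c g); move: e1 e2 e3.
rewrite !prP !prM => e1 e2 e3; split; last by rewrite -compA e2.
have [_ _ uz'] := hd_zP (datum X).
rewrite -prM -!prM; apply/prP; apply: (uz' _ (minus_Z X)).
by rewrite compBr compm1 prP !prM compA e2.
Qed.

Lemma heart_map_natural (X Y : B) (f : hom X Y) e e' : cot_plus c Y ->
  null c (s X ∘ e - z X) -> null c (s Y ∘ e' - z Y) ->
  pr c e' ∘ heart_map f = pr c f ∘ pr c e.
Proof.
move=> PY; have [h [f' [e1 e2]] ->] := heart_map_rel f.
have [_ es _] := hd_sP (datum Y); have [s' e3] := es _ PY (idm Y).
move: e1 e2 e3; rewrite !prP !prM => e1 e2 e3 eX eY.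
rewrite -[LHS]comp1m -[RHS]comp1m -[X in X ∘ _]e3 -[X in _ = X ∘ _]e3.
by rewrite -!compA; congr (comp _ _); rewrite !compA eY e2 -e1 -compA eX.
Qed.

End HeartMap.

(** * Comparing two hearts *)

Section HeartFunctor.
Variables (B : exact_category) (c d : cotorsion_pair B).
Hypothesis WK : forall T : B, cotW c T -> cotK d T.

Definition heart_obj (X : heart c) : heart d :=
  exist (cotH d) (hd_heart (datum d (sval X)))
    (conj (plus_Z d (sval X)) (minus_Z d (sval X))).

Definition heart_rep (X Y : heart c) (f : hom X Y) :
    @hom B (sval X) (sval Y) :=
  repr (f : quot_hom (cotW c) (sval X) (sval Y)).

Lemma heart_repK (X Y : heart c) (f : hom X Y) : pr c (heart_rep f) = f.
Proof. exact: quot_pi_surj. Qed.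

Definition heart_fmap (X Y : heart c) (f : hom X Y) :
  hom (heart_obj X) (heart_obj Y) := heart_map d (heart_rep f).

Lemma heart_map_pr (X Y : B) (f g : hom X Y) :
  pr c f = pr c g -> heart_map d f = heart_map d g.
Proof.
move=> /prP[T [a [b [WT e]]]]; apply: heart_map_eq.
by exists T, a, b; split=> //; exact: WK.
Qed.

Lemma heart_fmap_id X : heart_fmap (idm X) = idm (heart_obj X).
Proof.
by rewrite -[RHS]heart_map_id; apply: heart_map_pr; rewrite heart_repK.
Qed.

Lemma heart_fmap_comp X Y T (g : hom Y T) (f : hom X Y) :
  heart_fmap (g ∘ f) = heart_fmap g ∘ heart_fmap f.
Proof.
rewrite -[RHS]heart_map_comp; apply: heart_map_pr.
by rewrite heart_repK prM !heart_repK.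
Qed.

(** The functor B -> heart d, restricted to the heart of c; it descends to the
    quotient by the W of c because objects of K become zero. *)
Definition heart_functor : functor (heart c) (heart d) :=
  Functor heart_fmap_id heart_fmap_comp.

End HeartFunctor.

Section RoundTrip.
Variables (B : exact_category) (c d : cotorsion_pair B).
Hypotheses (Kcd : cotK c = cotK d).

Lemma cotW_sub_cotK (T : B) : cotW c T -> cotK c T.
Proof. by case=> UT _; exact: cotU_sub_cotK. Qed.

Lemma Kiso_eq (X Y : B) (f : hom X Y) : Kiso c f -> Kiso d f.
Proof. by rewrite /Kiso /Kmono /Kepi Kcd. Qed.

End RoundTrip.

(** For X in the heart of c, let X -> P <- Z be the reflection and coreflection
    for d. The functor to the heart of c inverts both arrows, and restricts to
    the identity on that heart; the composite isomorphism is natural because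
    each of its factors is. *)
Lemma round_trip (B : exact_category) (c d : cotorsion_pair B)
    (Kcd : cotK c = cotK d) (WKc : forall T : B, cotW c T -> cotK d T)
    (WKd : forall T : B, cotW d T -> cotK c T) :
  nat_isomorphic (functor_comp (heart_functor WKd) (heart_functor WKc))
    (functor_id (heart c)).
Proof.
have ex (X : heart c) : exists eta : @hom (quotW c) _ (sval X),
    is_iso eta /\ exists e w, [/\ null c (hd_s (datum c (sval X)) ∘ e
        - hd_z (datum c (sval X))),
      w ∘ heart_map c (hd_s (datum d (sval X))) = idm _,
      heart_map c (hd_s (datum d (sval X))) ∘ w = idm _ &
      eta = pr c e ∘ w ∘ heart_map c (hd_z (datum d (sval X)))].
  have [e [e1 ie]] := heart_map_on_heart (proj2_sig X).
  have Hi Y T (f : hom Y T) : Kiso d f -> is_iso (heart_map c f).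
    by move=> /(Kiso_eq (esym Kcd)); exact: heart_map_iso.
  have iz := Hi _ _ _ (hd_zK (datum d (sval X))).
  have [w [w1 w2]] := Hi _ _ _ (hd_sK (datum d (sval X))).
  exists (pr c e ∘ w ∘ heart_map c (hd_z (datum d (sval X)))); split.
    apply: is_iso_comp iz; apply: is_iso_comp ie _.
    by exists (heart_map c (hd_s (datum d (sval X)))).
  by exists e, w.
exists (fun X => projT1 (cid (ex X))); split.
  by move=> X; have [[g [g1 g2]] _] := projT2 (cid (ex X)); exists g.
move=> X Y f; have [_ [e [w [e1 w1 w2 ->]]]] := projT2 (cid (ex X)).
have [_ [e' [w' [e1' w1' w2' ->]]]] := projT2 (cid (ex Y)).
have [h [f' [e2 e3]] eh] := heart_map_rel d (heart_rep f).
have eHh : heart_map c (heart_rep (heart_fmap d f)) = heart_map c h.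
  by apply: (heart_map_pr WKd); rewrite heart_repK -eh.
have ef := heart_map_natural (heart_rep f) (proj2_sig Y).1 e1 e1'.
move: e2 e3; rewrite !prP => /(heart_map_pr WKd) + /(heart_map_pr WKd).
rewrite !heart_map_comp => e2 e3; rewrite heart_repK in ef.
suff: pr c e' ∘ w' ∘ heart_map c (hd_z (datum d (sval Y))) ∘
    heart_map c (heart_rep (heart_fmap d f)) =
    (f : @hom (quotW c) (sval X) (sval Y)) ∘
    (pr c e ∘ w ∘ heart_map c (hd_z (datum d (sval X)))) by [].
rewrite eHh -compA e3 !compA -ef.
congr (comp _ _); rewrite -!compA; congr (comp _ _).
by rewrite -[LHS]compm1 -w2 !compA -(compA w') e2 compA w1' comp1m.
Qed.

Theorem corollary1p5 (B : exact_category) (KS : Krull_Schmidt B)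
    (proj : enough_projectives B) (inj : enough_injectives B)
    (c1 c2 : cotorsion_pair B) (eqK : cotK c1 = cotK c2) :
  equivalent (heart c1) (heart c2).
Proof.
have W12 (T : B) : cotW c1 T -> cotK c2 T by rewrite -eqK; exact: cotW_sub_cotK.
have W21 (T : B) : cotW c2 T -> cotK c1 T by rewrite eqK; exact: cotW_sub_cotK.
exists (heart_functor W12), (heart_functor W21).
by split; apply: round_trip.
Qed.
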